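(* Let $n,m\ge 1$ be integers, let $\ell_{\max}=\lfloor nm/2\rfloor$, and let $\ell$ be an integer with $1\le \ell\le \ell_{\max}$. Let $\mathsf{P}=\mathsf{P}_{\ell,m,n}=\{z\in[0,m]^n : z_1+\cdots+z_n=\ell\}$. Then the $q$-Ehrhart series $E_{\mathsf{P}}(t,q)$ is a rational function of the form $$E_{\mathsf{P}}(t,q)=\frac{N(t,q)}{(1-q^{\ell}t)^{n-1}\prod_{j=0}^{\lceil \ell/m\rceil-1}(1-q^{jm}t)},\qquad N(t,q)\in\mathbb{Z}[t,q],$$ and, as an identity of rational functions, $$q^{n-1}\,\overline{E}_{\mathsf{P}}(t,q)=(-1)^n E_{\mathsf{P}}(1/t,1/q).$$ Moreover, if $n\ge 3$ and $2\ell=nm$, then the exponent $n-1$ of the factor $(1-q^\ell t)$ in the denominator can be replaced by $n-2$ (still with numerator in $\mathbb{Z}[t,q]$).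
   Context: Let $S=\mathbb{Q}[x_1,\dots,x_n]$ with the standard grading. For a nonzero $f\in S$ let $\tau(f)$ be its top-degree homogeneous component. For a finite set $Z\subset\mathbb{R}^n$ of lattice points, let $I(Z)=\{f\in S: f(z)=0 \text{ for all } z\in Z\}$, $\operatorname{gr}I(Z)=\langle \tau(f): 0\ne f\in I(Z)\rangle$, and $R(Z)=S/\operatorname{gr}I(Z)$, a graded ring with $\dim_{\mathbb{Q}}R(Z)=|Z|$. (If $Z=\emptyset$, $R(Z)=0$.) The Hilbert series of a graded vector space $V=\bigoplus_d V_d$ is $\operatorname{Hilb}(V;q)=\sum_d \dim(V_d)q^d$. For a lattice polytope $\mathsf{P}\subset\mathbb{R}^n$ and an integer $k\ge0$, write $k\mathsf{P}=\{kp:p\in \mathsf{P}\}$, let $i_{\mathsf{P}}(k;q)=\operatorname{Hilb}(R(k\mathsf{P}\cap\mathbb{Z}^n);q)$, and for $k\ge1$ let $\overline{i}_{\mathsf{P}}(k;q)=\operatorname{Hilb}(R(\operatorname{int}(k\mathsf{P})\cap\mathbb{Z}^n);q)$, where $\operatorname{int}$ is the relative interior. The $q$-Ehrhart series are $$E_{\mathsf{P}}(t,q)=\sum_{k\ge0} i_{\mathsf{P}}(k;q)\,t^k,\qquad \overline{E}_{\mathsf{P}}(t,q)=\sum_{k\ge1}\overline{i}_{\mathsf{P}}(k;q)\,t^k .$$ *)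

(* Defs.v *)
From HB Require Import structures.
From mathcomp Require Import all_boot all_order all_algebra.
From mathcomp Require Import fraction.
(* mpoly has to be imported before MathComp-Analysis: in the other order their
   notations clash. *)
From mathcomp Require Import mpoly.
From mathcomp Require Import boolp classical_sets reals topology normedtype.
From mathcomp Require Import ring.

Set Implicit Arguments.
Unset Strict Implicit.
Unset Printing Implicit Defensive.

Import Order.TTheory GRing.Theory Num.Theory.
Import numFieldNormedType.Exports.

Local Open Scope classical_set_scope.
Local Open Scope ring_scope.

Section OrbitHarmonics.
Variable n : nat.

Local Notation S := {mpoly rat[n]}.

Definition top_component (f : S) : S :=
  pihomog mdeg (msize f).-1 f.

Definition vanishing_ideal (Z : set 'rV[int]_n) : set S :=
  [set f | forall z, Z z -> f.@[fun i => (z 0 i)%:~R] = 0].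

Definition generated_ideal (G : set S) : set S :=
  [set f | exists k (a g : 'I_k -> S),
     (forall i, G (g i)) /\ f = \sum_i a i * g i].

Definition gr_ideal (Z : set 'rV[int]_n) : set S :=
  generated_ideal (top_component @` [set f | vanishing_ideal Z f /\ f != 0]).

(* A basis, given by homogeneous representatives of degree d, of the degree-d
   component S_d / (S_d `&` J) of the quotient of S by a homogeneous ideal J. *)
Definition quotient_basis (J : set S) (d k : nat) (b : 'I_k -> S) : Prop :=
  [/\ forall i, b i \is d.-homog,
      forall c : 'I_k -> rat, J (\sum_i c i *: b i) -> forall i, c i = 0
    & forall f, f \is d.-homog ->
        exists c : 'I_k -> rat, J (f - \sum_i c i *: b i)].

Definition quotient_dim (J : set S) (d : nat) : nat :=
  xget 0%N [set k | exists b : 'I_k -> S, quotient_basis J d b].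

(* The coefficient of q^d in Hilb(R(Z); q), where R(Z) = S / gr I(Z). *)
Definition hilb (Z : set 'rV[int]_n) (d : nat) : nat :=
  quotient_dim (gr_ideal Z) d.

End OrbitHarmonics.

Section Polytopes.
Variables (R : realType) (n : nat).

Definition affine_hull (P : set 'rV[R]_n) : set 'rV[R]_n :=
  [set y | exists k (a : 'I_k -> R) (p : 'I_k -> 'rV[R]_n),
     [/\ forall i, P (p i), \sum_i a i = 1 & y = \sum_i a i *: p i]].

Definition relint (P : set 'rV[R]_n) : set 'rV[R]_n :=
  [set x | P x /\ within (affine_hull P) (nbhs x) P].

Definition dilate (k : nat) (P : set 'rV[R]_n) : set 'rV[R]_n :=
  [set k%:R *: p | p in P].

Definition lattice_points (P : set 'rV[R]_n) : set 'rV[int]_n :=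
  [set z | P (map_mx intr z)].

Definition cube_slice (l m : nat) : set 'rV[R]_n :=
  [set z | (forall i, 0 <= z 0 i <= m%:R) /\ \sum_i z 0 i = l%:R].

End Polytopes.

(* A formal power series in t and q, F k d being the coefficient of t^k q^d. *)
Definition series2 := nat -> nat -> int.

Definition qEhrhart (R : realType) (n : nat) (P : set 'rV[R]_n) : series2 :=
  fun k d => (hilb (lattice_points (dilate k P)) d)%:Z.

Definition qEhrhart_int (R : realType) (n : nat) (P : set 'rV[R]_n) : series2 :=
  fun k d =>
    if k == 0%N then 0 else (hilb (lattice_points (relint (dilate k P))) d)%:Z.

(* Z[t,q] is {poly {poly int}}: the outer variable is t, the inner one is q. *)
Definition polytq := {poly {poly int}}.
Definition tP : polytq := 'X.
Definition qP : polytq := 'X%:P.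

Definition ratfun := {fraction polytq}.
Definition tF : ratfun := tofrac tP.
Definition qF : ratfun := tofrac qP.

Definition mul_polytq_series (D : polytq) (F : series2) : series2 :=
  fun k d => \sum_(i < k.+1) \sum_(j < d.+1) D`_i`_j * F (k - i)%N (d - j)%N.

(* The series F is (the expansion of) the rational function r. *)
Definition is_ratfun (F : series2) (r : ratfun) : Prop :=
  exists N D : polytq,
    [/\ D != 0, forall k d, mul_polytq_series D F k d = N`_k`_d
      & r = tofrac N / tofrac D].

(* N(1/t, 1/q) *)
Definition eval_inv (N : polytq) : ratfun :=
  (map_poly (fun c : {poly int} => (map_poly intr c).[qF^-1]) N).[tF^-1].

(* r(1/t, 1/q) *)
Definition subst_inv (r : ratfun) : ratfun :=
  eval_inv \n_(repr r) / eval_inv \d_(repr r).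

Definition ceil_div (a b : nat) : nat := ((a + b.-1) %/ b)%N.

(* (1 - q^l t)^e \prod_(0 <= j < ceil(l/m)) (1 - q^(jm) t) *)
Definition slice_denom (l m e : nat) : polytq :=
  (1 - qP ^+ l * tP) ^+ e *
  \prod_(0 <= j < ceil_div l m) (1 - qP ^+ (j * m) * tP).

(* hilb is well defined: S_d has bases modulo gr I(Z), all of the same size. *)
Section QuotientDim.
Variable n : nat.
Local Notation S := {mpoly rat[n]}.

Lemma generated_ideal0 (G : set S) : generated_ideal G 0.
Proof.
by exists 0%N, (fun=> 0), (fun=> 0); split=> [[]//|]; rewrite big_ord0.
Qed.

Lemma generated_idealP (G : set S) c f g :
  generated_ideal G f -> generated_ideal G g -> generated_ideal G (c *: f + g).
Proof.
move=> [k [a [u [Gu ->]]]] [k' [a' [u' [Gu' ->]]]].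
exists (k + k')%N,
  (fun i => match split i with inl i => c *: a i | inr i => a' i end),
  (fun i => match split i with inl i => u i | inr i => u' i end).
split=> [i|]; first by case: split.
rewrite big_split_ord /= scaler_sumr; congr (_ + _); apply: eq_bigr => i _.
  by rewrite (unsplitK (inl i)) scalerAl.
by rewrite (unsplitK (inr i)).
Qed.

Variable J : set S.
Hypotheses (J0 : J 0) (JP : forall c f g, J f -> J g -> J (c *: f + g)).

Let JD f g : J f -> J g -> J (f + g).
Proof. by move=> Jf Jg; rewrite -[f]scale1r; apply: JP. Qed.
Let JZ c f : J f -> J (c *: f).
Proof. by move=> Jf; rewrite -[_ *: _]addr0; apply: JP. Qed.
Let Jsum k (F : 'I_k -> S) : (forall i, J (F i)) -> J (\sum_i F i).
Proof. by move=> JF; elim/big_ind: _. Qed.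

Let free_le_span d k k' (b : 'I_k -> S) (b' : 'I_k' -> S) :
  (forall i, b i \is d.-homog) ->
  (forall c : 'I_k -> rat, J (\sum_i c i *: b i) -> forall i, c i = 0) ->
  (forall f, f \is d.-homog -> exists c : 'I_k' -> rat, J (f - \sum_i c i *: b' i)) ->
  (k <= k')%N.
Proof.
move=> hb fb sb'.
have /choice [C CE] : forall i, exists c : 'I_k' -> rat,
  J (b i - \sum_j c j *: b' j) by move=> i; apply: sb'.
pose A : 'M[rat]_(k, k') := \matrix_(i, j) C i j.
have: row_free A.
  apply/row_freeP; apply: contrapT => nA.
  have /rowV0Pn [v /sub_kermxP vA v0] : kermx A != 0.
    by apply/negP; rewrite kermx_eq0 => /row_freeP.
  case/negP: v0; apply/eqP/rowP => i; rewrite mxE.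
  apply: (fb (v 0)).
  have -> : \sum_i v 0 i *: b i = \sum_i v 0 i *: (b i - \sum_j C i j *: b' j).
    under [RHS]eq_bigr do rewrite scalerBr.
    rewrite sumrB (_ : \sum_i v 0 i *: (\sum_j C i j *: b' j) = 0) ?subr0 //.
    under eq_bigr do rewrite scaler_sumr.
    rewrite exchange_big /= big1 // => j _.
    under eq_bigr do rewrite scalerA.
    rewrite -scaler_suml; have /rowP/(_ j) := vA; rewrite !mxE.
    by under eq_bigr do rewrite mxE; move->; rewrite scale0r.
  by apply: Jsum => i'; apply: JZ.
by rewrite /row_free => /eqP <-; apply: rank_leq_col.
Qed.

Lemma quotient_dim_uniq d k k' (b : 'I_k -> S) (b' : 'I_k' -> S) :
  quotient_basis J d b -> quotient_basis J d b' -> k = k'.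
Proof.
move=> [hb fb sb] [hb' fb' sb']; apply/eqP; rewrite eqn_leq.
by rewrite (free_le_span hb fb sb') (free_le_span hb' fb' sb).
Qed.

Lemma quotient_basis_exists d : exists k, exists b : 'I_k -> S, quotient_basis J d b.
Proof.
pose free k := exists b : 'I_k -> S, (forall i, b i \is d.-homog) /\
  (forall c : 'I_k -> rat, J (\sum_i c i *: b i) -> forall i, c i = 0).
have f0 : exists k, `[<free k>].
  by exists 0%N; apply/asboolP; exists (fun=> 0); split=> [[]//|c _ []//].
pose T : finType := 'X_{1..n < d.+1}.
pose e (i : 'I_#|T|) : 'X_{1..n < d.+1} := enum_val i.
have bnd k : `[<free k>] -> (k <= #|T|)%N.
  move=> /asboolP[b [hb fb]].
  apply: (@free_le_span d _ _ b (fun i => 'X_[e i])) => // f hf.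
  exists (fun i => f@_(e i)).
  rewrite [X in f - X](_ : _ = f) ?subrr //.
  rewrite [RHS](@mpolywE _ _ d.+1); last first.
    rewrite msizeE; apply/bigmax_leqP_seq => m' mf _.
    by rewrite ltnS (dhomogP _ _ _ hf m' mf).
  rewrite [RHS](reindex e) //=.
  by exists (@enum_rank T) => ? _; [apply: enum_valK|apply: enum_rankK].
case: (ex_maxnP f0 bnd) => k /asboolP[b [hb fb]] kmax.
exists k, b; split=> // f hf; apply: contrapT => nf.
suff /asboolP/kmax : free k.+1 by rewrite ltnn.
exists (fun i => if unlift ord0 i is Some i then b i else f); split.
  by move=> i; case: unliftP.
move=> c; rewrite big_ord_recl unlift_none.
under eq_bigr do rewrite liftK.
move=> Jc.
have c0 : c ord0 = 0.
  apply: contrapT => /eqP c0; apply: nf.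
  exists (fun i => - ((c ord0)^-1 * c (lift ord0 i))).
  have := JZ (c ord0)^-1 Jc.
  rewrite scalerDr scalerA mulVf // scale1r scaler_sumr -sumrN.
  congr (J (_ + _)); apply: eq_bigr => i _.
  by rewrite scaleNr opprK scalerA.
move: Jc; rewrite c0 scale0r add0r => /fb cl i.
by case: (unliftP ord0 i) => [j|] ->.
Qed.

End QuotientDim.

Lemma hilbP n (Z : set 'rV[int]_n) d :
  exists b : 'I_(hilb Z d) -> {mpoly rat[n]}, quotient_basis (gr_ideal Z) d b.
Proof.
have := @xgetPex _ 0%N [set k | exists b : 'I_k -> {mpoly rat[n]}, quotient_basis (gr_ideal Z) d b].
apply; apply: quotient_basis_exists; first exact: generated_ideal0.
exact: generated_idealP.
Qed.

(* A series is the expansion of at most one rational function. *)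
Lemma coef_mul_polytq (D P : polytq) k d :
  (D * P)`_k`_d = mul_polytq_series D (fun i j => P`_i`_j) k d.
Proof.
rewrite coefM coef_sum; apply: eq_bigr => i _; exact: coefM.
Qed.

Lemma eq_mul_polytq (D : polytq) (F G : series2) k d :
  (forall i j, (i <= k)%N -> (j <= d)%N -> F i j = G i j) ->
  mul_polytq_series D F k d = mul_polytq_series D G k d.
Proof.
move=> FG; apply: eq_bigr => i _; apply: eq_bigr => j _.
by rewrite FG // leq_subr.
Qed.

Lemma is_ratfun_uniq (F : series2) (r s : ratfun) :
  is_ratfun F r -> is_ratfun F s -> r = s.
Proof.
move=> [N [D [D0 DF ->]]] [N' [D' [D'0 DF' ->]]].
apply/eqP; rewrite eqr_div ?tofrac_eq0 // -!tofracM tofrac_eq; apply/eqP.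
apply/polyP => k; apply/polyP => d.
pose G : polytq := \poly_(i < k.+1) \poly_(j < d.+1) F i j.
have GF i j : (i <= k)%N -> (j <= d)%N -> G`_i`_j = F i j.
  by move=> ik jd; rewrite !(coef_poly, ltnS) ik coef_poly ltnS jd.
have key (A B M : polytq) (BF : forall i j, mul_polytq_series B F i j = M`_i`_j) :
    (A * M)`_k`_d = (A * (B * G))`_k`_d.
  rewrite !coef_mul_polytq; apply: eq_mul_polytq => i j ik jd.
  rewrite coef_mul_polytq -BF; apply: eq_mul_polytq => i' j' i'i j'j.
  by rewrite GF // (leq_trans i'i, leq_trans j'j).
rewrite mulrC (key D' D N DF) (mulrC N' D) (key D D' N' DF').
by rewrite !mulrA (mulrC D').
Qed.

Lemma eval_inv_aux (K : fieldType) (c x y u v : K) : x != 0 -> y != 0 ->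
  c * v * u = u * x * (v * y) * (c * y^-1 * x^-1).
Proof. by move=> x0 y0; field; rewrite x0 y0. Qed.

Section EvalInv.
Let ev0 (c : {poly int}) : ratfun := (map_poly intr c).[qF^-1].
Let ev0_is_additive : zmod_morphism ev0.
Proof. by move=> a b; rewrite /ev0 rmorphB hornerD hornerN. Qed.
Let ev0_is_mult : monoid_morphism ev0.
Proof.
split; rewrite /ev0; first by rewrite rmorph1 hornerC.
by move=> a b; rewrite rmorphM hornerM.
Qed.
HB.instance Definition _ := GRing.isZmodMorphism.Build _ _ ev0 ev0_is_additive.
HB.instance Definition _ := GRing.isMonoidMorphism.Build _ _ ev0 ev0_is_mult.

Lemma eval_invM (A B : polytq) : eval_inv (A * B) = eval_inv A * eval_inv B.
Proof. by rewrite /eval_inv (rmorphM (map_poly ev0)) hornerM. Qed.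

Lemma eval_inv_eq0 (A : polytq) : (eval_inv A == 0) = (A == 0).
Proof.
apply/idP/idP => [/eqP A0|/eqP->]; last first.
  by rewrite /eval_inv map_poly0 horner0.
pose a := size A; pose b := (\max_(i < a) size (A`_i)%R)%N.
have q0 : qF != 0 by rewrite tofrac_eq0 polyC_eq0 polyX_eq0.
have t0 : tF != 0 by rewrite tofrac_eq0 polyX_eq0.
pose B : polytq := \poly_(i < a.+1) \poly_(j < b.+1) A`_(a - i)`_(b - j).
have EB : tofrac B = tF ^+ a * qF ^+ b * eval_inv A.
  have szm (f : {poly int} -> ratfun) : (size (map_poly f A) <= a.+1)%N.
    by rewrite (leq_trans (size_poly _ _)).
  rewrite /eval_inv (horner_coef_wide _ (szm _)) mulr_sumr.
  rewrite /B poly_def (reindex_inj rev_ord_inj) /= rmorph_sum /=.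
  apply: eq_bigr => i _; rewrite subSS (subKn (leq_ord i)).
  rewrite (coef_map ev0) /= -mul_polyC rmorphM /= rmorphXn /=.
  have szA : (size (map_poly intr A`_i : {poly ratfun}) <= b.+1)%N.
    rewrite (leq_trans (size_poly _ _)) // leqW //.
    case: (ltnP i a) => [ia|ai]; last by rewrite nth_default ?size_poly0.
    exact: (leq_bigmax (Ordinal ia)).
  rewrite /ev0 (horner_coef_wide _ szA) poly_def (reindex_inj rev_ord_inj) /=.
  rewrite !rmorph_sum /= mulr_suml mulr_suml mulr_sumr.
  apply: eq_bigr => j _; rewrite subSS (subKn (leq_ord j)).
  rewrite coef_map /= -mul_polyC !rmorphM /= !rmorphXn /= -/qF -/tF.
  rewrite -[in tF ^+ a](subnK (leq_ord i)) -[in qF ^+ b](subnK (leq_ord j)).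
  rewrite !exprD !exprVn.
  have -> : tofrac (A`_i`_j)%:P%:P = (A`_i`_j)%:~R :> ratfun.
    by rewrite -[A`_i`_j in LHS]intz !rmorph_int.
  move: (expf_neq0 i t0) (expf_neq0 j q0).
  move: (tF ^+ i) (qF ^+ j) (tF ^+ (a-i)) (qF ^+ (b-j)) => x y u v x0 y0.
  exact: (@eval_inv_aux {fraction polytq} _ x y u v x0 y0).
have B0 : B = 0.
  by apply/eqP; rewrite -tofrac_eq0 EB A0 mulr0.
apply/eqP/polyP => i; apply/polyP => j; rewrite !coef0.
case: (ltnP i a) => [ia|ai]; last by rewrite (nth_default 0 ai) coef0.
case: (ltnP j b) => [jb|bj]; last first.
  rewrite nth_default // (leq_trans _ bj) //.
  exact: (leq_bigmax (Ordinal ia)).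
have := congr1 (fun P : polytq => P`_(a - i)`_(b - j)) B0.
by rewrite /B !coef0 coef_poly ltnS leq_subr coef_poly ltnS leq_subr !subKn // ltnW.
Qed.
End EvalInv.

Lemma tofrac_numden (D : idomainType) (x : {ratio D}) :
  tofrac \n_x / tofrac \d_x = (\pi_({fraction D}) x)%qT.
Proof.
apply: (canLR (mulfK _)); rewrite ?tofrac_eq0 ?denom_ratioP //.
have -> : (\pi_({fraction D}) x)%qT * tofrac \d_x = FracField.mul (\pi_({fraction D}) x)%qT (tofrac \d_x) by [].
rewrite !piE; apply/eqmodP; rewrite /= FracField.equivfE /FracField.mulf.
by rewrite !numden_Ratio ?oner_eq0 ?mulr1 ?mul1r ?denom_ratioP // mulrC.
Qed.

(* subst_inv does not depend on the representative N / D. *)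
Lemma subst_invE (N D : polytq) : D != 0 ->
  subst_inv (tofrac N / tofrac D) = eval_inv N / eval_inv D.
Proof.
move=> D0; rewrite /subst_inv; set r := repr _.
have rE : tofrac N / tofrac D = tofrac \n_r / tofrac \d_r.
  by rewrite tofrac_numden reprK.
have d0 : \d_r != 0 by apply: denom_ratioP.
move/eqP: rE; rewrite eqr_div ?tofrac_eq0 // -!tofracM tofrac_eq => /eqP E.
apply/eqP; rewrite eqr_div ?eval_inv_eq0 // -!eval_invM E //.
Qed.

(* Main.v *)
Require Import Defs.
From HB Require Import structures.
From mathcomp Require Import all_boot all_order all_algebra.
From mathcomp Require Import fraction mpoly.
From mathcomp Require Import boolp classical_sets reals topology normedtype.
From mathcomp Require Import ring lra zify.

Set Implicit Arguments.
Unset Strict Implicit.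
Unset Printing Implicit Defensive.

Import Order.TTheory GRing.Theory Num.Theory.
Import numFieldNormedType.Exports.

Local Open Scope classical_set_scope.
Local Open Scope ring_scope.

(** The coefficient of q^d in Hilb(R(Z); q) is the increment, from degree d - 1
    to degree d, of the dimension of the space of functions on Z induced by
    polynomials. On the slice {z in {0..a}^n : sum z = L} with 2L <= na, the
    functions of degree at most d <= L are spanned by the products of binomials
    C(z_i, u_i) with sum u = d. These are linearly independent because the
    raising operator of the product of chains {0..a}^n is injective below the
    middle rank. Hence Hilb is the truncation in degrees <= L of
    (1 - q) [a + 1]_q^n, and the interior lattice points of kP form, up to
    translation by (1, .., 1), the slice with a = km - 2 and L = kl - n.

    Expanding (1 - q^(a+1))^n / (1 - q)^(n-1) and truncating expresses i_P(k; q)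
    as a combination of the sequences q^(jmk), for jm < l, and of q^(lk) times a
    polynomial in k of degree at most n - 2. This expression makes sense for all
    integers k, is annihilated by the stated denominator, and its value at -k and
    1/q is, up to the factor (-1)^(n-1) q^(n-1), the interior count at k.
    Reciprocity is then the classical one for two-sided recurrent sequences.
    When 2l = nm the coefficient of k^(n-2) is half of a vanishing n-th finite
    difference, so that one factor 1 - q^l t can be dropped. *)

(** * The Lefschetz property of a product of chains *)

Section Lefschetz.
Variables (n a : nat).
Local Notation T := {ffun 'I_n -> 'I_a.+1}.
Implicit Types (c g : T -> rat) (u v z : T).

Definition weight u : nat := (\sum_i u i)%N.

(** When a move would leave the box, [box_up] falls on the default value of [inord] and [box_down]
    fixes [u]; the coefficients [a - u i] and [v i] in [lower] and [raise] vanish exactly there. *)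
Definition box_up i u : T := [ffun j => if j == i then inord (u i).+1 else u j].
Definition box_down i u : T := [ffun j => if j == i then inord (u i).-1 else u j].

Lemma box_upE i u j : (u i < a)%N -> box_up i u j = (u j + (j == i))%N :> nat.
Proof.
move=> ua; rewrite ffunE; case: eqP => [->|_]; last by rewrite addn0.
by rewrite inordK ?addn1 // ltnS.
Qed.

Lemma box_downE i u j : box_down i u j = (u j - (j == i))%N :> nat.
Proof.
rewrite ffunE; case: eqP => [->|_]; last by rewrite subn0.
by rewrite inordK ?subn1 // (leq_ltn_trans (leq_pred _)).
Qed.

Lemma box_upK i u : (u i < a)%N -> box_down i (box_up i u) = u.
Proof. by move=> ua; apply/ffunP => j; apply/val_inj; rewrite /= box_downE box_upE // addnK. Qed.

Lemma box_downK i u : (0 < u i)%N -> box_up i (box_down i u) = u.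
Proof.
move=> ua; have da : (box_down i u i < a)%N.
  by rewrite box_downE eqxx; have := ltn_ord (u i); lia.
apply/ffunP => j; apply/val_inj; rewrite /= box_upE // box_downE.
by case: eqP => [->|_]; lia.
Qed.

Lemma weight_up i u : (u i < a)%N -> weight (box_up i u) = (weight u).+1.
Proof.
move=> ua; rewrite /weight (eq_bigr _ (fun j _ => box_upE j ua)) big_split /=.
by rewrite -(big_mkcond (fun j => j == i) (fun=> 1%N)) big_pred1_eq addn1.
Qed.

Lemma weight_down i u : (0 < u i)%N -> (weight (box_down i u)).+1 = weight u.
Proof.
move=> u0; rewrite -[in RHS](box_downK u0) weight_up // box_downE eqxx.
by have := ltn_ord (u i); lia.
Qed.

Lemma big_box_shift i (F : T -> T -> rat) :
  \sum_(v : T | (0 < v i)%N) F (box_down i v) v =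
  \sum_(u : T | (u i < a)%N) F u (box_up i u).
Proof.
rewrite (reindex_onto (box_up i) (box_down i)) => [|v]; last exact: box_downK.
apply: eq_big => [u|u]; last by case/andP=> _ /eqP->.
case: (ltnP (u i) a) => ua; first by rewrite box_upK // eqxx box_upE // eqxx addn1.
apply/negP => /andP[u0 /eqP E]; move: (congr1 (fun v => v i : nat) E).
rewrite /= box_downE eqxx; have := ltn_ord (box_up i u i).
move: u0 ua; set x := nat_of_ord _; set y := nat_of_ord _; lia.
Qed.

(** Together with [lower], this is the action of [sl_2] on the [n]-th tensor power of its
    irreducible representation of dimension [a + 1]; [box_weight] gives the inner product that makes
    the two operators adjoint. *)
Definition raise c v : rat := \sum_i (v i)%:R * c (box_down i v).
Definition lower c u : rat := \sum_i (a - u i)%:R * c (box_up i u).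
Definition box_weight u : rat := \prod_i 'C(a, u i)%:R.

Lemma box_weight_gt0 u : 0 < box_weight u.
Proof. by apply: prodr_gt0 => i _; rewrite ltr0n bin_gt0 -ltnS. Qed.

Lemma box_weight_up i u : (u i < a)%N ->
  (u i).+1%:R * box_weight (box_up i u) = (a - u i)%:R * box_weight u.
Proof.
move=> ua; rewrite /box_weight (bigD1 i) //= [in RHS](bigD1 i) //= !mulrA.
rewrite box_upE // eqxx addn1 -!natrM mul_bin_left; congr (_ * _).
by apply: eq_bigr => j /negPf ji; rewrite box_upE // ji addn0.
Qed.

(** In each coordinate, [big_box_shift] moves the sum to the lower neighbour, and
    [(u + 1) C(a, u + 1) = (a - u) C(a, u)] trades one coefficient for the other. *)
Lemma raise_lower_adjoint c g :
  \sum_v box_weight v * raise c v * g v = \sum_u box_weight u * c u * lower g u.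
Proof.
under eq_bigr do rewrite /raise mulr_sumr mulr_suml.
under [RHS]eq_bigr do rewrite /lower mulr_sumr.
rewrite exchange_big [RHS]exchange_big /=; apply: eq_bigr => i _.
rewrite (bigID (fun v : T => 0 < v i)%N) /= addrC big1 ?add0r; last first.
  by move=> v; rewrite -leqNgt leqn0 => /eqP->; rewrite mul0r mulr0 mul0r.
rewrite [RHS](bigID (fun u : T => u i < a)%N) /= [X in _ = _ + X]big1 ?addr0; last first.
  by move=> u; rewrite -leqNgt -subn_eq0 => /eqP->; rewrite mul0r mulr0.
rewrite (big_box_shift i (fun u v => box_weight v * ((v i)%:R * c u) * g v)).
apply: eq_bigr => u ua; rewrite box_upE // eqxx addn1.
have := box_weight_up ua; move: (box_weight _) (box_weight u) => w w' E.
by rewrite mulrA [w * _]mulrC E; ring.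
Qed.

(** The commutator is diagonal: moves in different coordinates commute, and within one coordinate
    [(a - u)(u + 1) - u (a - u + 1) = a - 2 u]. *)
Lemma lower_raise c u :
  lower (raise c) u = raise (lower c) u + \sum_i (a%:R - 2 * (u i)%:R) * c u.
Proof.
rewrite /lower /raise.
under eq_bigr do rewrite mulr_sumr.
under [X in _ = X + _]eq_bigr do rewrite mulr_sumr.
rewrite [X in _ = X + _]exchange_big /= -big_split /=; apply: eq_bigr => i _.
rewrite (bigD1 i) //= [X in _ = X + _](bigD1 i) //= addrAC; congr (_ + _).
  have ui := ltn_ord (u i); rewrite box_downE eqxx.
  case: (ltnP (u i) a) => ua; last first.
    have -> : (u i : nat) = a by lia.
    rewrite subnn mul0r; case: (posnP a) => [->|a0].
      by rewrite mul0r !mulr0 subrr mul0r addr0.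
    rewrite box_downK; last by lia.
    have -> : (a - (a - 1) = 1)%N by lia.
    by ring.
  rewrite box_upK // box_upE // eqxx.
  case: (posnP (u i)) => [->|u0].
    by rewrite mul0r add0r subn0 mulr0 subr0 add0n mul1r.
  rewrite box_downK // !mulrA -!mulrDl; congr (_ * _).
  rewrite addn1 subnBA // addn1 -natr1 !natrB // -?natr1; last lia.
  by ring.
apply: eq_bigr => j ji.
have [ua|ua] := ltnP (u i) a; last first.
  have -> : (u i : nat) = a by have := ltn_ord (u i); lia.
  rewrite subnn mul0r box_downE eq_sym (negPf ji) subn0.
  have -> : (u i : nat) = a by have := ltn_ord (u i); lia.
  by rewrite subnn mul0r mulr0.
rewrite box_upE // (negPf ji) addn0 box_downE [in RHS]eq_sym (negPf ji) subn0.
have -> : box_down j (box_up i u) = box_up i (box_down j u).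
  apply/ffunP => k; apply/val_inj; rewrite /= box_downE !box_upE //; last first.
    by rewrite box_downE eq_sym (negPf ji) subn0.
  rewrite box_downE; case: (eqVneq k j) => [->|]; last lia.
  by rewrite (negPf ji); lia.
by rewrite mulrCA.
Qed.

(* [sl_2]-argument: |raise c|^2 = |lower c|^2 + (n a - 2 d) |c|^2 for the inner
   product with weights [box_weight]. *)
Lemma raise_injective d c : (2 * d < n * a)%N ->
  (forall u, weight u != d -> c u = 0) -> (forall v, raise c v = 0) ->
  forall u, c u = 0.
Proof.
move=> da cd rc.
have: \sum_v box_weight v * raise c v * raise c v = 0.
  by rewrite big1 // => v _; rewrite rc mulr0.
rewrite raise_lower_adjoint; under eq_bigr do rewrite lower_raise mulrDr.
have E : \sum_u box_weight u * c u * raise (lower c) u =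
    \sum_u box_weight u * (lower c u * lower c u).
  under eq_bigr do rewrite mulrAC.
  by rewrite raise_lower_adjoint; apply: eq_bigr => u _; rewrite mulrA.
have F : \sum_u box_weight u * c u * (\sum_i (a%:R - 2 * (u i)%:R) * c u) =
    \sum_u (n * a - 2 * d)%:R * (box_weight u * (c u * c u)).
  apply: eq_bigr => u _; have [ud|ud] := eqVneq (weight u) d; last first.
    by rewrite cd //; ring.
  rewrite -mulr_suml sumrB sumr_const card_ord -mulr_sumr -natr_sum -/(weight u) ud.
  rewrite natrB; last lia.
  by rewrite !natrM -mulr_natr; ring.
rewrite big_split /= E F => S0 u.
have P1 : 0 <= \sum_u box_weight u * (lower c u * lower c u).
  by apply: sumr_ge0 => v _; rewrite mulr_ge0 ?(ltW (box_weight_gt0 v)) // -expr2 sqr_ge0.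
have P2 v : true -> 0 <= (n * a - 2 * d)%:R * (box_weight v * (c v * c v)).
  move=> _; rewrite -expr2 mulr_ge0 // mulr_ge0 ?sqr_ge0 //.
  exact/ltW/box_weight_gt0.
move/eqP: S0; rewrite (paddr_eq0 P1 (sumr_ge0 _ P2)) => /andP[_ /eqP].
move/(psumr_eq0P P2)/(_ u isT)/eqP; rewrite !mulf_eq0 orbb.
rewrite (gt_eqF (box_weight_gt0 u)) pnatr_eq0 /=.
by case/orP => [|/eqP//]; lia.
Qed.

(** * Independence of products of binomial coefficients on a level of the box *)

Definition binom_fun u z : rat := \prod_i 'C(z i, u i)%:R.

Lemma binom_fun_up i u z : (u i < a)%N ->
  (u i).+1%:R * binom_fun (box_up i u) z = ((z i)%:R - (u i)%:R) * binom_fun u z.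
Proof.
move=> ua; rewrite /binom_fun (bigD1 i) //= [in RHS](bigD1 i) //= !mulrA.
rewrite box_upE // eqxx addn1 -natrM mul_bin_left natrM.
congr (_ * _); last by apply: eq_bigr => j /negPf ji; rewrite box_upE // ji addn0.
have [zu|zu] := leqP (u i) (z i); first by rewrite natrB.
by rewrite bin_small // !mulr0.
Qed.

Lemma binom_fun_max i u z : u i = a :> nat ->
  ((z i)%:R - (u i)%:R) * binom_fun u z = 0.
Proof.
move=> ua; rewrite /binom_fun (bigD1 i) //= mulrA ua.
have [->|za] := eqVneq (z i : nat) a; first by rewrite subrr !mul0r.
rewrite bin_small ?mulr0 ?mul0r //; have := ltn_ord (z i); lia.
Qed.

(** This sums [(u + 1) C(z, u + 1) = (z - u) C(z, u)] over the coordinates. On a level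
    [weight z = L] it turns a linear relation among the functions of weight [d] into one among those
    of weight [d + 1]. *)
Lemma sum_raise_binom_fun c z :
  \sum_v raise c v * binom_fun v z =
  \sum_u ((weight z)%:R - (weight u)%:R) * (c u * binom_fun u z).
Proof.
under eq_bigr do rewrite /raise mulr_suml.
have E u : ((weight z)%:R - (weight u)%:R) * (c u * binom_fun u z) =
   \sum_i c u * (((z i)%:R - (u i)%:R) * binom_fun u z).
  rewrite /weight !natr_sum -sumrB mulr_suml; apply: eq_bigr => i _.
  by rewrite mulrCA.
under [RHS]eq_bigr do rewrite E.
rewrite exchange_big [RHS]exchange_big /=; apply: eq_bigr => i _.
rewrite (bigID (fun v : T => 0 < v i)%N) /= addrC big1 ?add0r; last first.
  by move=> v; rewrite -leqNgt leqn0 => /eqP->; rewrite !mul0r.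
rewrite [RHS](bigID (fun u : T => u i < a)%N) /= [X in _ = _ + X]big1 ?addr0; last first.
  move=> u; rewrite -leqNgt => ua; rewrite binom_fun_max ?mulr0 //.
  by have := ltn_ord (u i); lia.
rewrite (big_box_shift i (fun u v => (v i)%:R * c u * binom_fun v z)).
apply: eq_bigr => u ua; rewrite -binom_fun_up // box_upE // eqxx addn1.
by rewrite mulrCA mulrA.
Qed.

(** Distinct points of equal weight have a coordinate with [z i < u i], whose binomial vanishes. *)
Lemma binom_fun_level u z : weight u = weight z -> binom_fun u z = (u == z)%:R.
Proof.
move=> uz; have [->|/eqP neq] := eqVneq u z.
  by rewrite /binom_fun big1 // => i _; rewrite binn.
have [i zi] : exists i, (z i < u i)%N.
  apply/existsP; apply: contraPT neq; rewrite negb_exists => /forallP H; apply.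
  have le i : (u i <= z i)%N by rewrite leqNgt.
  apply/ffunP => i; apply/val_inj/eqP => /=.
  have := leqif_sum (fun i (_ : true) => leqif_eq (le i)).
  by move/geq_leqif; rewrite -/(weight u) -/(weight z) uz leqnn => /esym/forallP/(_ i).
by rewrite /binom_fun (bigD1 i) //= bin_small ?mul0r.
Qed.

(** Induction on [L - d]: [raise] carries a relation of weight [d] to one of weight [d + 1], trivial
    by induction, and [raise] is injective on weight [d < L]. For [d = L] the functions are
    indicators of points. *)
Lemma binom_fun_independent L d c : (2 * L <= n * a)%N -> (d <= L)%N ->
  (forall u, weight u != d -> c u = 0) ->
  (forall z, weight z = L -> \sum_u c u * binom_fun u z = 0) ->
  forall u, c u = 0.
Proof.
move=> La; move Ek : (L - d)%N => k; elim: k d c Ek => [|k IH] d c Ek dL cd c0 u.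
  have [ud|] := eqVneq (weight u) d; last exact: cd.
  have dE : d = L by lia.
  have := c0 u; rewrite ud dE => /(_ erefl); rewrite (bigD1 u) //= big1 ?addr0.
    by rewrite binom_fun_level // eqxx mulr1.
  move=> v vu; have [vd|/cd->] := eqVneq (weight v) d; last by rewrite mul0r.
  by rewrite binom_fun_level ?vd ?ud // (negPf vu) mulr0.
apply: (@raise_injective d) => // {u}; first lia.
apply: (IH d.+1); [lia|lia| |].
- move=> v vd; rewrite /raise big1 // => i _.
  case: (posnP (v i)) => [->|v0]; first by rewrite mul0r.
  by rewrite cd ?mulr0 // -eqSS weight_down.
- move=> z zL; rewrite sum_raise_binom_fun.
  have E u : ((weight z)%:R - (weight u)%:R) * (c u * binom_fun u z) =
     (L%:R - d%:R) * (c u * binom_fun u z).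
    by have [->|/cd->] := eqVneq (weight u) d; rewrite ?zL // mul0r !mulr0.
  by under eq_bigr do rewrite E; rewrite -mulr_sumr c0 ?mulr0.
Qed.

End Lefschetz.

(** * Orbit harmonics: Hilbert function as increments of evaluation ranks *)

Lemma span_closed (K : fieldType) (V : vectType K) (Q : V -> Prop) (X : seq V) :
  Q 0 -> (forall k u v, Q u -> Q v -> Q (k *: u + v)) ->
  (forall u, u \in X -> Q u) -> forall v, v \in <<X>>%VS -> Q v.
Proof.
move=> Q0 QP; elim: X => [|x X IH] QX v; first by rewrite span_nil memv0 => /eqP->.
rewrite span_cons => /memv_addP[u /vlineP[k ->] [w wX ->]].
apply: QP; first by apply: QX; rewrite mem_head.
by apply: IH wX => y yX; apply: QX; rewrite inE yX orbT.
Qed.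

(** * Top-degree components and the associated graded ideal *)

Section MpolyDegree.
Variable n : nat.
Local Notation S := {mpoly rat[n]}.
Implicit Types (p q f g : S) (m : 'X_{1..n}).

Lemma mcoeff_pihomog d p m : (pihomog mdeg d p)@_m = if mdeg m == d then p@_m else 0.
Proof.
rewrite pihomogE raddf_sum /=; under eq_bigr do rewrite mcoeffZ mcoeffX.
have [mp|mp] := boolP (m \in msupp p); last first.
  rewrite (memN_msupp_eq0 mp) if_same big_seq_cond big1 // => m' /andP[m'p _].
  by case: eqP m'p mp => [->->//|]; rewrite mulr0.
rewrite big_mkcond /= (bigD1_seq m) ?msupp_uniq //= eqxx mulr1 big1 ?addr0 //.
by move=> m' /negPf ->; rewrite mulr0 if_same.
Qed.

Lemma msize_leP p d : reflect (forall m, (d <= mdeg m)%N -> p@_m = 0) (msize p <= d)%N.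
Proof.
apply: (iffP idP) => [pd m dm|H].
  by apply/memN_msupp_eq0/msize_mdeg_ge/(leq_trans pd).
rewrite msizeE; apply/bigmax_leqP_seq => m mp _; rewrite ltnNge.
by apply: contraL mp => /H E; rewrite mcoeff_msupp E eqxx.
Qed.

Lemma pihomog_msize p d : (msize p <= d)%N -> pihomog mdeg d p = 0.
Proof.
move/msize_leP => H; apply/mpolyP => m; rewrite mcoeff_pihomog mcoeff0.
by case: eqP => // E; rewrite H ?E.
Qed.

Lemma msize_dhomog p d : p \is d.-homog -> (msize p <= d.+1)%N.
Proof.
move=> pd; apply/msize_leP => m dm; apply: (dhomog_nemf_coeff pd).
by rewrite gtn_eqF.
Qed.

Lemma msize_sub_pihomog p d : (msize p <= d.+1)%N ->
  (msize (p - pihomog mdeg d p) <= d)%N.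
Proof.
move/msize_leP=> pd; apply/msize_leP => m dm; rewrite mcoeffB mcoeff_pihomog.
case: eqP => [_|/eqP dm']; first by rewrite subrr.
by rewrite subr0 pd // ltn_neqAle eq_sym dm'.
Qed.

Lemma msizeD_leq p q d : (msize p <= d)%N -> (msize q <= d)%N -> (msize (p + q) <= d)%N.
Proof. by move=> pd qd; rewrite (leq_trans (mmeasureD_le _ _ _)) // geq_max pd. Qed.

Lemma msizeM_leq p q d e : (msize p <= d.+1)%N -> (msize q <= e)%N ->
  (msize (p * q) <= d + e)%N.
Proof.
have [->|p0] := eqVneq p 0; first by rewrite mul0r msize0.
have [->|q0] := eqVneq q 0; first by rewrite mulr0 msize0.
by rewrite msizeM //; move: (msize p) (msize q) => x y; lia.
Qed.

Lemma vanishing_idealD (Z : set 'rV[int]_n) f g :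
  vanishing_ideal Z f -> vanishing_ideal Z g -> vanishing_ideal Z (f + g).
Proof. by move=> If Ig z Zz; rewrite mevalD If // Ig // addr0. Qed.

Lemma vanishing_idealM (Z : set 'rV[int]_n) f g :
  vanishing_ideal Z g -> vanishing_ideal Z (f * g).
Proof. by move=> Ig z Zz; rewrite mevalM Ig // mulr0. Qed.

Lemma vanishing_ideal0 (Z : set 'rV[int]_n) : vanishing_ideal Z 0.
Proof. by move=> z _; rewrite meval0. Qed.

(** The property is stable under sums, so a monomial times a top component is enough; there the same
    monomial times the whole vanishing polynomial is a witness. *)
Lemma gr_ideal_pihomog (Z : set 'rV[int]_n) f d : gr_ideal Z f ->
  exists2 h, vanishing_ideal Z h &
    (msize h <= d.+1)%N /\ pihomog mdeg d h = pihomog mdeg d f.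
Proof.
pose Q f := exists2 h, vanishing_ideal Z h &
    (msize h <= d.+1)%N /\ pihomog mdeg d h = pihomog mdeg d f.
have Q0 : Q 0.
  by exists 0; [exact: vanishing_ideal0|rewrite msize0].
have QD f1 f2 : Q f1 -> Q f2 -> Q (f1 + f2).
  move=> [h1 I1 [s1 E1]] [h2 I2 [s2 E2]]; exists (h1 + h2).
    exact: vanishing_idealD.
  by split; [exact: msizeD_leq | rewrite !pihomogD E1 E2].
move=> [k [a [u [Gu ->]]]]; rewrite -/(Q _).
elim/big_ind: _ => // i _; have [g [Ig g0] <-] := Gu i.
rewrite [a i]mpolyE mulr_suml; elim/big_ind: _ => // m _.
rewrite /top_component; set s := (msize g).-1; set c := _@_m.
have gs : (msize g <= s.+1)%N by rewrite /s; case: (msize g).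
have hX : c *: 'X_[m] \is (mdeg m).-homog by rewrite rpredZ // dhomogX.
have hs : c *: 'X_[m] * pihomog mdeg s g \is (mdeg m + s).-homog.
  by apply: dhomogM => //; apply: pihomogP.
(* A product homogeneous of another degree has no component in degree [d], so [0] is a witness. *)
have [E|ne] := eqVneq (mdeg m + s)%N d; last first.
  by exists 0; [exact: vanishing_ideal0|rewrite msize0 pihomog0 (pihomog_ne0 ne hs)].
exists (c *: 'X_[m] * g); first exact: vanishing_idealM.
have le := msizeM_leq (msize_dhomog hX).
split; first by rewrite -E -addnS le.
rewrite -[g in LHS](subrK (pihomog mdeg s g)) mulrDr pihomogD.
by rewrite pihomog_msize ?add0r // -E le // msize_sub_pihomog.
Qed.

(** If [g] exists, [f] is the top component of [f - g]; the converse is [gr_ideal_pihomog]. Since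
    [msize] is the degree plus one, [g] has degree below [d]: this is why the Hilbert function
    counts rank increments. *)
Lemma gr_ideal_dhomogP (Z : set 'rV[int]_n) f d : f \is d.-homog ->
  gr_ideal Z f <-> exists2 g, (msize g <= d)%N & vanishing_ideal Z (f - g).
Proof.
move=> fd; split=> [/(gr_ideal_pihomog d)[h Ih [hd]]|[g gd Ifg]].
  rewrite (pihomog_dE fd) => E; exists (f - h); last by rewrite subKr.
  by rewrite -opprB mmeasureN -E msize_sub_pihomog.
have [->|f0] := eqVneq f 0; first exact: generated_ideal0.
have top : pihomog mdeg d (f - g) = f.
  by rewrite pihomogB (pihomog_dE fd) pihomog_msize ?subr0.
exists 1%N, (fun=> 1), (fun=> f); rewrite big_ord1 mul1r; split=> // _.
exists (f - g).
  by split=> //; apply: contraNneq f0 => E; rewrite -top E pihomog0.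
rewrite /top_component (_ : (msize _).-1 = d) //.
suff -> : msize (f - g) = d.+1 by [].
apply/eqP; rewrite eqn_leq msizeD_leq ?mmeasureN ?(leqW gd) ?msize_dhomog //=.
by rewrite ltnNge; apply: contraNN f0 => /pihomog_msize; rewrite top => ->.
Qed.

End MpolyDegree.

(** * Functions on a finite point set induced by polynomials *)

Section Evaluation.
Variables (n : nat) (T : finType) (pt : T -> 'rV[int]_n) (Z : set 'rV[int]_n).
Hypothesis ZE : forall z, Z z <-> exists t, z = pt t.
Local Notation S := {mpoly rat[n]}.
Implicit Types (p q f g : S).

Definition evalv p : {ffun T -> rat^o} := [ffun t => p.@[fun i => (pt t 0 i)%:~R]].

Lemma evalvP c p q : evalv (c *: p + q) = c *: evalv p + evalv q.
Proof. by apply/ffunP => t; rewrite !ffunE mevalD mevalZ. Qed.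

Lemma evalv0 : evalv 0 = 0.
Proof. by apply/ffunP => t; rewrite !ffunE meval0. Qed.

Lemma evalv_sum k (c : 'I_k -> rat) (b : 'I_k -> S) :
  evalv (\sum_i c i *: b i) = \sum_i c i *: evalv (b i).
Proof.
elim/big_rec2: _ => [|i v p _ <-]; first exact: evalv0.
by rewrite -evalvP.
Qed.

Lemma evalv_eq p q : evalv p = evalv q <-> vanishing_ideal Z (p - q).
Proof.
split=> [E z /ZE[t ->]|I].
  by have := congr1 (fun f : {ffun T -> rat^o} => f t) E; rewrite !ffunE mevalB => ->; rewrite subrr.
by apply/ffunP => t; rewrite !ffunE; apply/subr0_eq; rewrite -mevalB I //; apply/ZE; exists t.
Qed.

(** The index is a strict bound on the degree, so the space is zero for [d = 0]. *)
Definition evalv_space d : {vspace {ffun T -> rat^o}} :=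
  <<[seq evalv 'X_[m] | m : 'X_{1..n < d}]>>.

Lemma evalv_spaceP d v : v \in evalv_space d <-> exists2 p, (msize p <= d)%N & v = evalv p.
Proof.
split.
  rewrite /evalv_space; move: v.
  apply: span_closed => [|k u v [p pd ->] [q qd ->]|u /mapP[m _ ->]].
  - by exists 0; rewrite ?msize0 ?evalv0.
  - exists (k *: p + q); last by rewrite evalvP.
    by rewrite msizeD_leq // (leq_trans (mmeasureZ_le _ _ _)).
  - by exists 'X_[m] => //; rewrite msizeX bmdeg.
move=> [p pd ->]; rewrite (mpolywE pd).
elim/big_ind: _ => [|x y xd yd|m _].
- by rewrite evalv0 mem0v.
- by rewrite -[x]scale1r evalvP scale1r memvD.
- rewrite -[_ *: _]addr0 evalvP evalv0 addr0 memvZ // memv_span //.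
  by apply/mapP; exists m; rewrite ?mem_enum.
Qed.

Lemma evalv_spaceS d e : (d <= e)%N -> (evalv_space d <= evalv_space e)%VS.
Proof.
move=> de; apply/subvP => v /evalv_spaceP[p pd ->]; apply/evalv_spaceP.
by exists p => //; apply: leq_trans de.
Qed.

Lemma dim_evalv_space0 : \dim (evalv_space 0) = 0%N.
Proof.
apply/eqP; rewrite dimv_eq0 -subv0; apply/subvP => v /evalv_spaceP[p].
by rewrite leqn0 msize_poly_eq0 => /eqP-> ->; rewrite evalv0 mem0v.
Qed.

(** The values of a homogeneous basis of the degree [d] quotient span a complement of
    [evalv_space d] in [evalv_space d.+1]. *)
Lemma dim_evalv_spaceS d : \dim (evalv_space d.+1) = (hilb Z d + \dim (evalv_space d))%N.
Proof.
have [b [bd bfree bspan]] := hilbP Z d.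
set k := hilb Z d in b bd bfree bspan *.
pose X := [tuple evalv (b i) | i < k].
have inX v : v \in <<X>>%VS -> exists c : 'I_k -> rat, v = evalv (\sum_i c i *: b i).
  move: v; apply: span_closed => [|c u v [cu ->] [cv ->]|u /mapP[i _ ->]].
  - exists (fun=> 0); rewrite big1 ?evalv0 // => i _; exact: scale0r.
  - exists (fun i => c * cu i + cv i); rewrite -evalvP scaler_sumr -big_split /=.
    by congr evalv; apply: eq_bigr => i _; rewrite scalerA scalerDl.
  - exists (fun j => (j == i)%:R); rewrite (bigD1 i) //= eqxx scale1r big1 ?addr0 //.
    by move=> j /negPf ->; rewrite scale0r.
have homog_sum c : \sum_i c i *: b i \is d.-homog by apply: rpred_sum => i _; rewrite rpredZ.
(* A combination agreeing on the points with a polynomial of degree below [d] lies in the graded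
   ideal. This gives both the freeness of [X] and the trivial intersection. *)
have low0 c : evalv (\sum_i c i *: b i) \in evalv_space d -> forall i, c i = 0.
  move=> /evalv_spaceP[g gd /evalv_eq I]; apply: bfree.
  by apply/(gr_ideal_dhomogP _ (homog_sum c)); exists g.
have freeX : free X.
  apply/freeP => c; under eq_bigr do rewrite -tnth_nth tnth_mktuple.
  by rewrite -evalv_sum => E; apply: low0; rewrite E mem0v.
have <- : \dim <<X>> = k by move: freeX; rewrite /free => /eqP ->; rewrite size_tuple.
rewrite -dimv_disjoint_sum; last first.
  apply/eqP; rewrite -subv0; apply/subvP => v; rewrite memv_cap => /andP[/inX[c ->]].
  by move/low0=> c0; rewrite big1 ?evalv0 ?mem0v // => i _; rewrite c0 scale0r.
congr (\dim _); apply/eqP; rewrite eqEsubv; apply/andP; split; last first.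
  rewrite subv_add evalv_spaceS // andbT; apply/subvP => v /inX[c ->].
  apply/evalv_spaceP; exists (\sum_i c i *: b i) => //.
  exact: msize_dhomog (homog_sum c).
apply/subvP => v /evalv_spaceP[p pd ->].
(* The degree [d] part of [p] is a combination of the basis up to a function [g] of lower degree. *)
have [c Jc] := bspan _ (pihomogP mdeg d p).
have hd : pihomog mdeg d p - \sum_i c i *: b i \is d.-homog.
  by apply: rpredB; [exact: pihomogP|exact: homog_sum].
have [g gd I] := (gr_ideal_dhomogP _ hd).1 Jc.
have -> : evalv p = evalv (\sum_i c i *: b i) + evalv (p - pihomog mdeg d p + g).
  rewrite -[evalv (\sum_i _)]scale1r -evalvP scale1r; apply/evalv_eq.
  rewrite (_ : p - _ = pihomog mdeg d p - \sum_i c i *: b i - g) //.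
  move: (pihomog _ _ _) (\sum_i _) => x y; rewrite !opprD opprK !addrA addrAC.
  by rewrite [p - y]addrC addrK addrC addrA [x + _]addrC.
rewrite memv_add //; last first.
  by apply/evalv_spaceP; exists (p - pihomog mdeg d p + g); rewrite // msizeD_leq ?msize_sub_pihomog.
rewrite evalv_sum; apply: memv_suml => i _; rewrite memvZ // memv_span //.
by apply/mapP; exists i; rewrite ?mem_enum.
Qed.

End Evaluation.

(** * Hilbert functions of box slices *)

Section SliceHilbert.
Variables (n a s L : nat).
Hypothesis La : (2 * L <= n * a)%N.
Local Notation T := {ffun 'I_n -> 'I_a.+1}.

(** The offset [s] is 0 for the lattice points of a slice and 1 for those of its interior. *)
Definition slice_points : set 'rV[int]_n :=
  [set z | exists2 u : T, weight u = L & forall i, z 0 i = (s + u i)%N%:Z].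

Local Notation level := {u : T | weight u == L}.
Local Notation V := {ffun level -> rat^o}.

Let pt (t : level) : 'rV[int]_n := \row_i (s + val t i)%N%:Z.

Let slice_pointsE z : slice_points z <-> exists t, z = pt t.
Proof.
split=> [[u /eqP uL zu]|[t ->]].
  by exists (exist _ u uL); apply/rowP => i; rewrite mxE zu.
by exists (val t) => [|i]; [exact/eqP/(valP t)|rewrite mxE].
Qed.

Definition binomv (u : T) : V := [ffun t => binom_fun u (val t)].

Definition binomv_space d : {vspace V} :=
  <<[tuple binomv (enum_val i) | i < #|[pred u : T | weight u == d]|]>>.

Lemma binomv_mem u d : weight u = d -> binomv u \in binomv_space d.
Proof.
move=> ud; have uA : u \in [pred u : T | weight u == d] by rewrite inE ud.
apply/memv_span/mapP; exists (enum_rank_in uA u); first by rewrite mem_enum.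
by rewrite enum_rankK_in.
Qed.

Lemma binomv_space_closed d (Q : V -> Prop) :
  Q 0 -> (forall k v w, Q v -> Q w -> Q (k *: v + w)) ->
  (forall u, weight u = d -> Q (binomv u)) -> forall v, v \in binomv_space d -> Q v.
Proof.
move=> Q0 QP Qb; apply: span_closed => // v /mapP[i _ ->]; apply: Qb.
by have := enum_valP i; rewrite inE => /eqP.
Qed.

Lemma dim_binomv_space d : (d <= L)%N ->
  \dim (binomv_space d) = #|[pred u : T | weight u == d]|.
Proof.
move=> dL; rewrite /binomv_space; set X := mktuple _.
suff : free X by rewrite /free => /eqP->; rewrite size_tuple.
apply/freeP => k; under eq_bigr do rewrite -tnth_nth tnth_mktuple.
move=> E; pose c u := \sum_(i | enum_val i == u) k i.
have cE i : c (enum_val i) = k i.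
  by rewrite /c (big_pred1 i) // => j; rewrite /= (inj_eq enum_val_inj).
suff c0 u : c u = 0 by move=> i; rewrite -cE c0.
move: u; apply: (binom_fun_independent La dL) => [u ud|z /eqP zL].
  rewrite /c big_pred0 // => i; apply: contraNF ud => /eqP<-.
  by have := enum_valP i; rewrite inE.
have := congr1 (fun f : V => f (exist _ z zL)) E; rewrite sum_ffunE ffunE => E'.
rewrite -[RHS]E'.
under eq_bigr do rewrite /c mulr_suml.
rewrite (exchange_big_dep predT) //=; apply: eq_bigr => i _.
by rewrite (big_pred1 (enum_val i)) ?ffunE // => u; rewrite /= eq_sym.
Qed.

Let coordv (i : 'I_n) (v : V) : V := [ffun t : level => (val t i)%:R * v t].

Let binomv_up i u d : weight u = d ->
  coordv i (binomv u) - (u i)%:R *: binomv u \in binomv_space d.+1.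
Proof.
move=> ud; have [ua|ua] := ltnP (u i) a.
  suff -> : coordv i (binomv u) - (u i)%:R *: binomv u = (u i).+1%:R *: binomv (box_up i u).
    by rewrite memvZ // binomv_mem // weight_up // ud.
  by apply/ffunP => t; rewrite !ffunE [RHS]binom_fun_up // mulrBl.
suff -> : coordv i (binomv u) - (u i)%:R *: binomv u = 0 by rewrite mem0v.
apply/ffunP => t; rewrite !ffunE -mulrBl binom_fun_max //.
by have := ltn_ord (u i); lia.
Qed.

(** On the level, the factors [z_i - u_i] add up to [L - d], which is nonzero, and each of them
    multiplies [binomv u] into weight [d + 1]. *)
Lemma binomv_spaceS d : (d < L)%N -> (binomv_space d <= binomv_space d.+1)%VS.
Proof.
move=> dL; apply/subvP; apply: binomv_space_closed => [|k v w|u ud].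
- exact: mem0v.
- by move=> vd wd; rewrite memvD ?memvZ.
have -> : binomv u = (L%:R - d%:R)^-1 *:
    \sum_i (coordv i (binomv u) - (u i)%:R *: binomv u).
  apply/ffunP => t; rewrite !ffunE sum_ffunE; under eq_bigr do rewrite !ffunE -mulrBl.
  rewrite -mulr_suml sumrB -!natr_sum -/(weight _) -/(weight _) (eqP (valP t)) ud.
  by rewrite [RHS]mulKf // subr_eq0 eqr_nat gtn_eqF.
by rewrite memvZ // memv_suml // => i _; apply: binomv_up.
Qed.

Let coordv_mem i d v : (d < L)%N -> v \in binomv_space d -> coordv i v \in binomv_space d.+1.
Proof.
move=> dL; move: v; apply: binomv_space_closed => [|k v w vd wd|u ud].
- by have -> : coordv i 0 = 0; [apply/ffunP => t; rewrite !ffunE mulr0|rewrite mem0v].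
- have -> : coordv i (k *: v + w) = k *: coordv i v + coordv i w.
    by apply/ffunP => t; rewrite !ffunE mulrDr; congr (_ + _); apply: mulrCA.
  by rewrite memvD ?memvZ.
- rewrite -[coordv _ _](subrK ((u i)%:R *: binomv u)) memvD ?binomv_up // memvZ //.
  by apply: (subvP (binomv_spaceS dL)); apply: binomv_mem.
Qed.

(** One variable is split off at a time; multiplication by a box coordinate raises the weight bound
    by one, and the offset [s] only adds a multiple of the smaller monomial. *)
Lemma evalv_monomial_mem d (m : 'X_{1..n}) : (d <= L)%N -> (mdeg m <= d)%N ->
  evalv pt 'X_[m] \in binomv_space d.
Proof.
elim: d m => [|d IH] m dL.
  rewrite leqn0 mdeg_eq0 => /eqP->.
  have -> : evalv pt 'X_[0] = binomv [ffun=> ord0].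
    apply/ffunP => t; rewrite !ffunE mpolyX0 meval1 /binom_fun big1 // => i _.
    by rewrite ffunE bin0.
  by rewrite binomv_mem // /weight big1 // => i _; rewrite ffunE.
rewrite leq_eqVlt ltnS => /orP[/eqP md|md]; last first.
  exact/(subvP (binomv_spaceS dL))/IH/md/ltnW.
have [i mi] : exists i, (0 < m i)%N.
  apply/existsP; rewrite -[X in is_true X]negbK negb_exists; apply/negP => /forallP m0.
  move: md; rewrite mdegE big1 // => i _; apply/eqP; rewrite -leqn0 leqNgt; exact: m0.
have mE : m = (U_(i) + (m - U_(i)))%MM by rewrite addmC submK // lep1mP -lt0n.
have md' : (mdeg (m - U_(i))%MM <= d)%N.
  by move: md; rewrite {1}mE mdegD mdeg1; lia.
have -> : evalv pt 'X_[m] = s%:R *: evalv pt 'X_[m - U_(i)] + coordv i (evalv pt 'X_[m - U_(i)]).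
  apply/ffunP => t; rewrite !ffunE {1}mE mpolyXD mevalM mevalXU mxE -mulrDl.
  by rewrite -natrD.
have IHm := IH _ (ltnW dL) md'.
by rewrite memvD ?coordv_mem // memvZ // (subvP (binomv_spaceS dL)).
Qed.

Lemma binomv_poly d (u : T) : weight u = d ->
  exists2 p, (msize p <= d.+1)%N & binomv u = evalv pt p.
Proof.
elim: d u => [|d IH] u ud.
  exists 1; first by rewrite msize1.
  apply/ffunP => t; rewrite !ffunE meval1 /binom_fun big1 // => i _.
  move/eqP: ud; rewrite /weight sum_nat_eq0 => /forallP/(_ i)/eqP ->.
  by rewrite bin0.
have [i ui] : exists i, (0 < u i)%N.
  apply/existsP; rewrite -[X in is_true X]negbK negb_exists; apply/negP => /forallP m0.
  move: ud; rewrite /weight big1 // => i _; apply/eqP; rewrite -leqn0 leqNgt; exact: m0.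
have [p pd pE] : exists2 p, (msize p <= d.+1)%N & binomv (box_down i u) = evalv pt p.
  by apply: IH; apply/eq_add_S; rewrite weight_down.
(* This is the recursion [C(y, u) = (y - (u - 1)) / u * C(y, u - 1)] at [y = X_i - s]. *)
exists ((u i)%:R^-1 *: (('X_i - (s + (u i).-1)%:R%:MP) * p)).
  rewrite (leq_trans (mmeasureZ_le _ _ _)) // -[d.+2]add1n.
  apply: msizeM_leq => //; apply: msizeD_leq; first by rewrite msizeX mdeg1.
  by rewrite mmeasureN mmeasureC; case: (_ != 0).
apply/ffunP => t; rewrite !ffunE mevalZ mevalM mevalB mevalXU mevalC mxE.
have := congr1 (fun f : V => f t) pE; rewrite !ffunE => <-.
have da : (box_down i u i < a)%N.
  by rewrite box_downE eqxx; have := ltn_ord (u i); lia.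
have := binom_fun_up (val t) da; rewrite box_downK //.
rewrite box_downE eqxx subn1 prednK // => E.
apply: (canRL (mulKf _)); first by rewrite pnatr_eq0 -lt0n.
rewrite E; congr (_ * _); rewrite natrD -[_%:~R]/((s + _)%:R) natrD; ring.
Qed.

Lemma evalv_space_binomv d : (d <= L)%N -> evalv_space pt d.+1 = binomv_space d.
Proof.
move=> dL; apply/eqP; rewrite eqEsubv; apply/andP; split.
  apply/subvP; apply: span_closed => [|k v w vd wd|v /mapP[m _ ->]].
  - exact: mem0v.
  - by rewrite memvD ?memvZ.
  - by apply: evalv_monomial_mem; rewrite // -ltnS bmdeg.
apply/subvP; apply: binomv_space_closed => [|k v w vd wd|u /binomv_poly H].
- exact: mem0v.
- by rewrite memvD ?memvZ.
- exact/evalv_spaceP.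
Qed.

(** The functions of weight [L] are the indicators of the points of the level. *)
Lemma binomv_space_full v : v \in binomv_space L.
Proof.
have -> : v = \sum_t v t *: binomv (val t).
  apply/ffunP => t; rewrite sum_ffunE (bigD1 t) //= big1 ?addr0 => [|t' tt'].
    by rewrite !ffunE binom_fun_level // eqxx [RHS]mulr1.
  rewrite !ffunE binom_fun_level ?(eqP (valP t)) ?(eqP (valP t')) //.
  by rewrite (inj_eq val_inj) (negPf tt') [LHS]mulr0.
by rewrite memv_suml // => t _; rewrite memvZ // binomv_mem //; apply/eqP/(valP t).
Qed.

Lemma dim_evalv_space_slice d :
  \dim (evalv_space pt d.+1) = #|[pred u : T | weight u == minn d L]|.
Proof.
have [dL|dL] := leqP d L; first by rewrite evalv_space_binomv ?dim_binomv_space.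
rewrite -dim_binomv_space //; congr (\dim _); apply/eqP; rewrite eqEsubv.
apply/andP; split; first by apply/subvP => v _; apply: binomv_space_full.
by rewrite -evalv_space_binomv // evalv_spaceS // ltnS ltnW.
Qed.

Lemma coef_box_poly d :
  ((\sum_(i < a.+1) 'X^i : {poly int}) ^+ n)`_d = #|[pred u : T | weight u == d]|%:Z.
Proof.
rewrite -[X in _ ^+ X]card_ord -prodr_const bigA_distr_bigA /= coef_sum.
under eq_bigr do rewrite -expr_sum coefXn.
rewrite -natr_sum natz -sum1_card [in RHS]big_mkcond /=; congr (Posz _).
apply: eq_bigr => u _; rewrite inE eq_sym.
by case: eqP.
Qed.

(** The evaluation ranks count the box points of weight [d] up to [d = L] and are constant
    afterwards; the factor [1 - 'X] takes the increments. *)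
Lemma hilb_slice_points d :
  (hilb slice_points d)%:Z =
  if (d <= L)%N then ((1 - 'X) * (\sum_(i < a.+1) 'X^i : {poly int}) ^+ n)`_d else 0.
Proof.
have := dim_evalv_spaceS slice_pointsE d; rewrite dim_evalv_space_slice.
rewrite mulrBl mul1r coefB coefXM !coef_box_poly.
case: d => [|d]; first by rewrite min0n dim_evalv_space0 addn0 => <-; rewrite subr0.
rewrite dim_evalv_space_slice /=; case: (leqP d.+1 L) => dL.
  rewrite (minn_idPl (ltnW dL)) => E; lia.
rewrite (minn_idPr _) //; lia.
Qed.

End SliceHilbert.

(** * Lattice points of dilated slices and their interiors *)

Section CubeSlice.
Variables (R : realType) (n : nat).
Hypothesis n_gt0 : (0 < n)%N.

Let n0 : n%:R != 0 :> R.
Proof. by rewrite pnatr_eq0 -lt0n. Qed.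

Lemma cube_slice_center L M : (L <= n * M)%N ->
  @cube_slice R n L M (const_mx (L%:R / n%:R)).
Proof.
move=> LM; split=> [i|]; rewrite ?mxE.
  rewrite divr_ge0 ?ler0n //= ler_pdivrMr ?ltr0n // -natrM ler_nat mulnC //.
under eq_bigr do rewrite mxE.
by rewrite sumr_const card_ord -[RHS](divfK n0) mulr_natr.
Qed.

Lemma dilate_cube_slice k l m : (l <= n * m)%N ->
  dilate k (@cube_slice R n l m) = cube_slice (k * l) (k * m).
Proof.
move=> lm; apply/seteqP; split=> [_ [p [pm pl] <-]|x [xm xl]].
  split=> [i|]; rewrite ?mxE.
    have /andP[p0 pm'] := pm i.
    by rewrite mulr_ge0 //= natrM ler_wpM2l.
  under eq_bigr do rewrite mxE.
  by rewrite -mulr_sumr pl natrM.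
(* For [k = 0] the origin lies in the dilate only because the slice is nonempty, as its center
   shows. *)
have [k0|k0] := posnP k.
  exists (const_mx (l%:R / n%:R)); first exact: cube_slice_center.
  apply/rowP => i; rewrite !mxE k0 mul0r.
  by have := xm i; rewrite k0 mul0n -eq_le => /eqP.
have kR : k%:R != 0 :> R by rewrite pnatr_eq0 -lt0n.
exists (k%:R^-1 *: x); last by rewrite scalerA divff // scale1r.
split=> [i|]; rewrite ?mxE.
  have /andP[x0 xm'] := xm i.
  rewrite mulr_ge0 ?invr_ge0 //= mulrC ler_pdivrMr ?ltr0n // -natrM mulnC //.
under eq_bigr do rewrite mxE.
by rewrite -mulr_sumr xl natrM mulKf.
Qed.

Lemma affine_hull_cube_slice L M (y : 'rV[R]_n) :
  affine_hull (cube_slice L M) y -> \sum_i y 0 i = L%:R.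
Proof.
move=> [k [a [p [Pp a1 ->]]]]; under eq_bigr do rewrite summxE.
rewrite exchange_big /=.
have E i : \sum_j (a i *: p i) 0 j = a i * L%:R.
  under eq_bigr do rewrite mxE.
  by rewrite -mulr_sumr (Pp i).2.
by under eq_bigr do rewrite E; rewrite -mulr_suml a1 mul1r.
Qed.

(** The segment from the center [c] to [x] can be prolonged slightly beyond [x] inside the slice. As
    [c] is strictly inside the cube, a coordinate of [x] equal to a bound would overstep it. *)
Lemma relint_cube_slice_le L M (x : 'rV[R]_n) : (0 < L < n * M)%N ->
  relint (cube_slice L M) x -> forall i, 0 < x 0 i < M%:R.
Proof.
move=> /andP[L0 LM] [Px Wx] i; have [/(_ i)/andP[x0 xM] _] := Px.
pose c : 'rV[R]_n := const_mx (L%:R / n%:R).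
have c0 : 0 < c 0 i by rewrite mxE divr_gt0 ?ltr0n.
have cM : c 0 i < M%:R by rewrite mxE ltr_pdivrMr ?ltr0n // -natrM ltr_nat mulnC.
have hull e : affine_hull (cube_slice L M) (x + e *: (x - c)).
  exists 2%N, (fun j => if j == ord0 then 1 + e else - e),
              (fun j => if j == ord0 then x else c); split.
  - by move=> j; case: ifP => // _; apply/cube_slice_center/ltnW.
  - by rewrite big_ord_recl big_ord1 /= addrK.
  - by rewrite big_ord_recl big_ord1 /= scalerDl scale1r scaleNr scalerBr addrA.
have [e e0 He] : exists2 e : R, 0 < e & cube_slice L M (x + e *: (x - c)).
  have : x + e *: (x - c) @[e --> (0 : R)^'+] --> x + 0 *: (x - c).
    apply: cvgD; first exact: cvg_cst.
    apply: cvgZr_tmp; apply: cvg_at_right_filter; exact: cvg_id.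
  rewrite scale0r addr0 => /(_ _ Wx); rewrite /nbhs /= => H.
  near (0 : R)^'+ => e; exists e; first by near: e; exact: nbhs_right_gt.
  have : affine_hull (cube_slice L M) (x + e *: (x - c)) -> cube_slice L M (x + e *: (x - c)).
    by near: e; exact: H.
  by apply; apply: hull.
have [/(_ i)] := He; rewrite !mxE => /andP[y0 yM] _.
rewrite !lt_neqAle x0 xM !andbT eq_sym; apply/andP; split; apply/eqP => E.
  by move: y0; rewrite E !mxE in c0 *; nra.
by move: yM; rewrite E !mxE in cM *; nra.
Unshelve. all: by end_near. Qed.

(** The open cube is a neighbourhood of [x], and the affine hull stays in the hyperplane of sum
    [L]. *)
Lemma relint_cube_slice_ge L M (x : 'rV[R]_n) :
  (forall i, 0 < x 0 i < M%:R) -> \sum_i x 0 i = L%:R -> relint (cube_slice L M) x.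
Proof.
move=> x0 xL; split.
  by split=> // i; have /andP[a b] := x0 i; rewrite !ltW.
have : nbhs x [set y | forall i, 0 < (y : 'rV[R]_n) 0 i < M%:R].
  apply: (@filter_forall 'rV[R]_n 'I_n (fun i (y : 'rV[R]_n) => 0 < y 0 i < M%:R) (nbhs x) _) => i.
  have xi : x 0 i \in `]0, M%:R[ by rewrite in_itv /= x0.
  apply: (@filterS _ (nbhs x) _ _ _ _ (@coord_continuous R 1 n 0 i x _ (near_in_itvoo xi))).
  by move=> y; rewrite /= in_itv.
rewrite /within /=; apply: filterS => y y0 /affine_hull_cube_slice yL.
by split=> // i; have /andP[a b] := y0 i; rewrite !ltW.
Qed.

Lemma lattice_points_cube_slice L M :
  lattice_points (@cube_slice R n L M) = @slice_points n M 0 L.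
Proof.
apply/seteqP; split=> z.
  move=> [z0 zL].
  have zN i : exists2 k : nat, (k <= M)%N & z 0 i = k.
    have := z0 i; rewrite mxE; case: (z 0 i) => k; last by rewrite ler0z.
    by rewrite -[_%:~R]/(k%:R) ler_nat => /andP[_ kM]; exists k.
  exists [ffun i => inord `|z 0%R i|%N] => [|i].
    apply/eqP; rewrite -(eqr_nat R) -zL natr_sum; apply/eqP/eq_bigr => i _.
    by have [k kM E] := zN i; rewrite mxE ffunE E inordK.
  by have [k kM E] := zN i; rewrite ffunE E inordK.
move=> [u uL zu]; split=> [i|].
  by rewrite mxE zu -[_%:~R]/((u i)%:R) ler0n ler_nat -ltnS ltn_ord.
by rewrite -uL natr_sum; apply: eq_bigr => i _; rewrite mxE zu.
Qed.

Lemma lattice_points_relint L M : (0 < L < n * M)%N ->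
  lattice_points (relint (@cube_slice R n L M)) =
  if (n <= L)%N then @slice_points n (M - 2) 1 (L - n) else set0.
Proof.
move=> LM.
have E : lattice_points (relint (@cube_slice R n L M)) =
    [set z | (forall i, 0 < z 0 i < M%:Z) /\ \sum_i z 0 i = L%:Z].
  have castE (z : 'rV[int]_n) :
      (\sum_i (map_mx intr z : 'rV[R]_n) 0 i == L%:R) = (\sum_i z 0 i == L%:Z).
    rewrite -(eqr_int R) rmorph_sum /=; congr (_ == _).
    by apply: eq_bigr => i _; rewrite mxE.
  have castlt (z : 'rV[int]_n) i :
      (0 < (map_mx intr z : 'rV[R]_n) 0 i < M%:R) = (0 < z 0 i < M%:Z).
    by rewrite mxE ltr0z -[M%:R]/((M%:Z)%:~R) ltr_int.
  apply/seteqP; split=> z.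
    move=> rz; split=> [i|]; first by rewrite -castlt; exact: (relint_cube_slice_le LM rz i).
    by apply/eqP; rewrite -castE; apply/eqP; case: rz => -[].
  move=> [z0 /eqP zL]; apply: relint_cube_slice_ge => [i|]; first by rewrite castlt.
  by apply/eqP; rewrite castE.
rewrite {}E; apply/seteqP; split=> z.
  move=> [z0 zL].
  have zN i : exists2 k : nat, (k < M - 1)%N & z 0 i = (1 + k)%N.
    have := z0 i; case: (z 0 i) => k // kM; exists k.-1; lia.
  have kL : (\sum_i (`|z 0%R i|.-1)%N)%N = (L - n)%N /\ (n <= L)%N.
    have: (\sum_i (`|z 0%R i|.-1)%N + n)%N = L.
      rewrite -[n in (_ + n)%N]card_ord -sum1_card -big_split /=.
      apply/eqP; rewrite -eqz_nat -zL -!natz natr_sum; apply/eqP/eq_bigr => i _.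
      by have [k _ ->] := zN i; rewrite natz /= addn1.
    lia.
  rewrite kL.2; exists [ffun i => inord (`|z 0%R i|.-1)%N] => [|i].
    rewrite -kL.1; apply: eq_bigr => i _; rewrite ffunE inordK //.
    by have [k kM ->] := zN i; rewrite /=; lia.
  by have [k kM E] := zN i; rewrite ffunE E inordK //; lia.
case: ifP => // nL [u uL zu].
(* The subtraction [M - 2] is not truncated: [n <= L < n * M] excludes [M <= 1]. *)
have M2 : (2 <= M)%N.
  case: M LM u uL zu => [|[|M]] //; first by lia.
  move=> LM u uL _; lia.
split=> [i|]; first by rewrite zu; have := ltn_ord (u i); lia.
rewrite (eq_bigr _ (fun i _ => zu i)) -(subnK nL) -uL.
have nE : n = (\sum_(i < n) 1)%N by rewrite sum1_card card_ord.
rewrite [X in (_ + X)%N]nE -big_split /= -natz natr_sum.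
by apply: eq_bigr => i _; rewrite natz addnC.
Qed.

End CubeSlice.

(** * Truncated binomial series *)

Section TruncatedBinomial.
Variable K : fieldType.
Hypothesis char0 : forall k, k.+1%:R != 0 :> K.
Implicit Types (x : K) (N : int) (e i : nat).

(* [rising_binom i N] is the binomial coefficient C(N + i, i), for [N] in [int]. *)
Definition rising_binom i N : K := (i`!%:R)^-1 * \prod_(u < i) (N%:~R + u.+1%:R).

Let fact_neq0 i : i`!%:R != 0 :> K.
Proof. by have := fact_gt0 i; case: i`!. Qed.

Lemma rising_binom0 N : rising_binom 0 N = 1.
Proof. by rewrite /rising_binom big_ord0 mulr1 invr1. Qed.

Lemma rising_binomS i N :
  rising_binom i.+1 N - rising_binom i.+1 (N - 1) = rising_binom i N.
Proof.
rewrite /rising_binom -mulrBr big_ord_recr big_ord_recl /=.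
have -> : \prod_(u < i) ((N - 1)%:~R + (bump 0 u).+1%:R) = \prod_(u < i) (N%:~R + u.+1%:R) :> K.
  by apply: eq_bigr => u _; rewrite rmorphB /= /bump add1n -[u.+2%:R]natr1; ring.
rewrite rmorphB /= factS natrM; move: (fact_neq0 i) (char0 i).
move: (\prod_(u < i) _) (i`!%:R) (i.+1%:R) => P a b a0 b0.
by field; rewrite a0 b0.
Qed.

(** Negation reverses the order of the factors and changes their signs; this is
    [C(i - N, i) = (-1)^i C(N - 1, i)]. *)
Lemma rising_binomN i N :
  rising_binom i (- N) = (-1) ^+ i * rising_binom i (N - 1 - i%:Z).
Proof.
rewrite /rising_binom mulrCA; congr (_ * _).
rewrite -[X in (-1) ^+ X]card_ord -prodr_const -big_split /=.
rewrite (reindex_inj rev_ord_inj) /=; apply: eq_bigr => u _.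
rewrite subnSK // natrB ?(ltnW (ltn_ord u)) // !rmorphB !rmorphN /= -natr1.
by rewrite -[(Posz i)%:~R]/(i%:R); ring.
Qed.

Lemma rising_binom_eq0 i N : - i%:Z <= N -> N <= -1 -> rising_binom i N = 0.
Proof.
case: N => // N iN _; have Ni : (N < i)%N by lia.
rewrite /rising_binom (bigD1 (Ordinal Ni)) //= NegzE rmorphN /=.
by rewrite addrC subrr mul0r mulr0.
Qed.

Lemma rising_binom_nat i (N : nat) : rising_binom i N%:Z = 'C(N + i, i)%:R.
Proof.
elim: i N => [|i IH] N; first by rewrite rising_binom0 bin0.
elim: N => [|N IHN].
  rewrite add0n binn /rising_binom.
  apply: (canLR (mulKf _)) => //; rewrite mulr1; elim: i.+1 => [|k IHk].
    by rewrite big_ord0.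
  by rewrite big_ord_recr /= IHk add0r -natrM mulnC -factS.
rewrite -[LHS](subrK (rising_binom i.+1 (N.+1%:Z - 1))) rising_binomS IH.
by rewrite subzSS subr0 IHN -natrD [in RHS]addSn binS addnC addSnnS.
Qed.

(* For [N >= -e], the sum of the terms of degree at most [N] in the expansion
   of [(1 - x)^-e] (lemmas [trunc_binom_nat] and [trunc_binom_eq0]). *)
Definition trunc_binom e N x : K :=
  (1 - x ^ (N + 1) * \sum_(i < e) rising_binom i N * (1 - x) ^+ i) / (1 - x) ^+ e.

Lemma trunc_binom0 N x : trunc_binom 0 N x = 1.
Proof. by rewrite /trunc_binom big_ord0 mulr0 subr0 divr1. Qed.

Section Fixed.
Variable x : K.
Hypotheses (x0 : x != 0) (x1 : 1 - x != 0).

Lemma trunc_binomS e N :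
  (1 - x) * trunc_binom e.+1 N x = trunc_binom e N x - rising_binom e N * x ^ (N + 1).
Proof.
rewrite /trunc_binom big_ord_recr /= exprS.
have := expf_neq0 e x1; move: (\sum_(i < e) _) (x ^ _) (rising_binom _ _) => S y b.
by move: ((1 - x) ^+ e) => z z0; field; rewrite z0 x1.
Qed.

(** Induction on [e] through [trunc_binomS], for every integer [N]. By Pascal's rule the difference
    on the right is the coefficient of [x ^ N] in [(1 - x)^-e]. *)
Lemma trunc_binom_diff e N :
  trunc_binom e N x - trunc_binom e (N - 1) x =
  (rising_binom e N - rising_binom e (N - 1)) * x ^ N.
Proof.
elim: e => [|e IH]; first by rewrite !trunc_binom0 !rising_binom0 !subrr mul0r.
apply: (mulfI x1); rewrite mulrBr !trunc_binomS rising_binomS subrK.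
rewrite expfzDr // expr1z.
have -> (a b c d y : K) : a - b * (y * x) - (c - d * y) = (a - c) - b * y * x + d * y by ring.
by rewrite IH; ring.
Qed.

Lemma trunc_binom_nat e (N : nat) :
  trunc_binom e N%:Z x = \sum_(r < N.+1) 'C((r + e).-1, r)%:R * x ^+ r.
Proof.
elim: N => [|N IH].
  rewrite big_ord1 expr0 bin0 mulr1; case: e => [|e]; first by rewrite trunc_binom0.
  have -> : trunc_binom e.+1 0 x = trunc_binom e.+1 (-1) x + 1.
    apply/eqP; rewrite -subr_eq0 opprD addrA subr_eq0 -[-1]add0r trunc_binom_diff rising_binomS.
    by rewrite (rising_binom_nat e 0) binn mul1r expr0z.
  rewrite /trunc_binom addNr expr0z mul1r big_ord_recl /= rising_binom0 mul1r big1.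
    by rewrite addr0 subrr mul0r add0r.
  by move=> i _; rewrite rising_binom_eq0 ?mul0r //; lia.
rewrite big_ord_recr /= -IH -[LHS](subrK (trunc_binom e (N.+1%:Z - 1) x)).
rewrite trunc_binom_diff subzSS subr0 addrC; congr (_ + _); rewrite exprnP; congr (_ * _).
case: e {IH} => [|e]; first by rewrite !rising_binom0 subrr addn0 bin_small.
have -> : N%:Z = N.+1%:Z - 1 by lia.
rewrite rising_binomS rising_binom_nat addnS /=; congr (_%:R).
by rewrite -bin_sub ?leq_addl // addnK.
Qed.

(** Descending from the value 1 at [N = 0], the first step removes the constant term and the next
    ones remove zero coefficients, by [rising_binom_eq0]. *)
Lemma trunc_binom_eq0 e N : - e%:Z <= N -> N <= -1 -> trunc_binom e N x = 0.
Proof.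
case: e => [|e]; first lia.
case: N => // N Ne _; elim: N Ne => [|N IH] Ne.
  have -> : Negz 0 = 0 - 1 by [].
  have E : trunc_binom e.+1 0 x = 1.
    by rewrite (trunc_binom_nat e.+1 0) big_ord1 bin0 expr0 mulr1.
  have := trunc_binom_diff e.+1 0; rewrite rising_binomS E (rising_binom_nat e 0) binn.
  by rewrite expr0z mul1r => H; rewrite -[LHS](subKr 1) H subrr.
have := trunc_binom_diff e.+1 (Negz N); rewrite rising_binomS IH; last lia.
rewrite rising_binom_eq0 ?mul0r; [|lia|lia].
have -> : Negz N - 1 = Negz N.+1 by lia.
by rewrite sub0r => /eqP; rewrite oppr_eq0 => /eqP.
Qed.

(** Induction on [e]: the recursions at [x^-1] and at [x] match through [rising_binomN], up to a
    multiple of [x ^ M] supplied by [trunc_binom_diff]. *)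
Lemma trunc_binom_recip e N :
  trunc_binom e (- N) x^-1 = (-1) ^+ e * x ^+ e * trunc_binom e (N - 1 - e%:Z) x.
Proof.
have y1 : 1 - x^-1 != 0.
  by apply: contraNneq x1 => /eqP; rewrite subr_eq0 eq_sym invr_eq1 eq_sym -subr_eq0 => /eqP->.
have y0 : x^-1 != 0 by rewrite invr_eq0.
elim: e => [|e IH]; first by rewrite !trunc_binom0 !expr0 !mul1r.
apply: (mulfI y1).
have -> : (1 - x^-1) * trunc_binom e.+1 (- N) x^-1 =
   trunc_binom e (- N) x^-1 - rising_binom e (- N) * x^-1 ^ (- N + 1).
  rewrite /trunc_binom big_ord_recr /= exprS.
  have := expf_neq0 e y1; move: (\sum_(i < e) _) (_ ^ _) (rising_binom _ _) => S y b.
  by move: y1 ((1 - x^-1) ^+ e); move: (1 - x^-1) => w w0 z z0; field; rewrite z0 w0.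
set M := N - 1 - e%:Z.
have -> : N - 1 - e.+1%:Z = M - 1 by rewrite /M; lia.
have -> : (1 - x^-1) * ((-1) ^+ e.+1 * x ^+ e.+1 * trunc_binom e.+1 (M - 1) x) =
    (-1) ^+ e * x ^+ e * ((1 - x) * trunc_binom e.+1 (M - 1) x).
  by rewrite !exprS; field.
rewrite IH -/M trunc_binomS subrK rising_binomN -/M.
have -> : x^-1 ^ (- N + 1) = x ^+ e * x ^ M.
  by rewrite -exprN1 exprz_exp exprnP -expfzDr //; congr (_ ^ _); rewrite /M; lia.
rewrite -[trunc_binom e M x](subrK (trunc_binom e (M - 1) x)) trunc_binom_diff.
ring.
Qed.

End Fixed.
End TruncatedBinomial.

(** * Closed form of the truncated Hilbert series *)

Lemma coef_mul1X (A : {poly int}) d :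
  ((1 - 'X) * A)`_d = A`_d - (if d is d'.+1 then A`_d' else 0).
Proof. by rewrite mulrBl mul1r coefB coefXM; case: d. Qed.

(** Division by [1 - 'X] takes partial sums, which Pascal's rule evaluates. For [e = 0] the
    truncated predecessor makes the binomial 1 at [u = d] and 0 elsewhere. *)
Lemma coef_div_1subX (A B : {poly int}) e d : (1 - 'X) ^+ e * A = B ->
  A`_d = \sum_(u < d.+1) B`_u * 'C((d - u + e).-1, d - u)%:R.
Proof.
elim: e A d => [|e IH] A d AB.
  rewrite big_ord_recr /= subnn bin0 mulr1 big1 => [|u _].
    by rewrite -AB expr0 mul1r add0r.
  by rewrite addn0 bin_small ?mulr0 // prednK // subn_gt0.
have {}AB : (1 - 'X) ^+ e * ((1 - 'X) * A) = B by rewrite mulrA -exprSr.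
have {}IH k := IH _ k AB.
elim: d => [|d IHd].
  by have := IH 0%N; rewrite coef_mul1X subr0 !big_ord1 => ->; rewrite !bin0.
have := IH d.+1; rewrite coef_mul1X IHd => /(canRL (subrK _)) ->.
rewrite big_ord_recr [RHS]big_ord_recr /= subnn !bin0 addrAC -big_split /=.
congr (_ + _); apply: eq_bigr => u _; rewrite -mulrDr -natrD.
have ud : (u <= d)%N by rewrite -ltnS.
by rewrite subSn // !addSn !addnS /= binS.
Qed.

Lemma geom_poly (b : nat) :
  (1 - 'X) * \sum_(i < b) 'X^i = 1 - 'X^b :> {poly int}.
Proof.
have := subrXX (1 : {poly int}) 'X b; rewrite expr1n => ->; congr (_ * _).
by apply: eq_bigr => i _; rewrite expr1n mul1r.
Qed.

Section HornerInt.
Variables (K : fieldType) (x : K).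

Definition int_horner (c : {poly int}) : K := (map_poly intr c).[x].

Lemma int_horner_is_zmod_morphism : zmod_morphism int_horner.
Proof. by move=> a b; rewrite /int_horner rmorphB hornerD hornerN. Qed.
Lemma int_horner_is_monoid_morphism : monoid_morphism int_horner.
Proof.
split; rewrite /int_horner; first by rewrite rmorph1 hornerC.
by move=> a b; rewrite rmorphM hornerM.
Qed.
HB.instance Definition _ :=
  GRing.isZmodMorphism.Build {poly int} K int_horner int_horner_is_zmod_morphism.
HB.instance Definition _ :=
  GRing.isMonoidMorphism.Build {poly int} K int_horner int_horner_is_monoid_morphism.

Lemma int_horner_X : int_horner 'X = x.
Proof. by rewrite /int_horner map_polyX hornerX. Qed.

Lemma int_horner_poly N (A : nat -> int) :
  int_horner (\poly_(d < N) A d) = \sum_(d < N) (A d)%:~R * x ^+ d.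
Proof.
rewrite poly_def rmorph_sum /=; apply: eq_bigr => d _.
by rewrite -mul_polyC rmorphM rmorphXn /= int_horner_X /int_horner map_polyC hornerC.
Qed.

End HornerInt.

Section ClosedForm.
Variable K : fieldType.
Hypothesis char0 : forall k, k.+1%:R != 0 :> K.
Variable x : K.
Hypotheses (x0 : x != 0) (x1 : 1 - x != 0).

Lemma sum_shifted_binom e L c : (c <= L)%N ->
  \sum_(d < L.+1) (if (c <= d)%N then 'C((d - c + e).-1, d - c)%:R else 0) * x ^+ d =
  x ^+ c * trunc_binom e (L%:Z - c%:Z) x.
Proof.
move=> cL; rewrite subzn // trunc_binom_nat // mulr_sumr.
rewrite -(big_mkord xpredT (fun d => (if (c <= d)%N then 'C((d - c + e).-1, d - c)%:R else 0) * x ^+ d)).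
rewrite (@big_cat_nat _ _ _ c) //=; last by rewrite ltnW.
rewrite big_nat_cond big1 ?add0r; last first.
  by move=> d; rewrite andbT => /andP[_ dc]; rewrite leqNgt dc mul0r.
rewrite -{1}[c]add0n big_addn subSn // big_mkord; apply: eq_bigr => r _.
by rewrite leq_addl addnK exprD mulrCA mulrC [in RHS]mulrC mulrAC.
Qed.

(** The polynomial is [(1 - 'X^b)^(e+1) / (1 - 'X)^e], expanded and truncated. Terms with
    [L < j * b] contribute nothing, and [P] may retain those with [L - j * b >= - e], where
    [trunc_binom] vanishes; one index set can thus serve all dilations. *)
Lemma trunc_box_poly e b L (P : pred nat) : (0 < b)%N ->
  (forall j, (j <= e.+1)%N -> P j -> - e%:Z <= L%:Z - (j * b)%N%:Z) ->
  (forall j, (j <= e.+1)%N -> ~~ P j -> (L < j * b)%N) ->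
  int_horner x (\poly_(d < L.+1) ((1 - 'X) * (\sum_(i < b) 'X^i) ^+ e.+1)`_d) =
  \sum_(j < e.+2 | P j) (-1) ^+ j * 'C(e.+1, j)%:R *
     (x ^+ (j * b) * trunc_binom e (L%:Z - (j * b)%N%:Z) x).
Proof.
move=> b0 PL NPL; set A := (1 - 'X) * _.
have AB : (1 - 'X) ^+ e * A = \sum_(j < e.+2) ((-1) ^+ j * 'X^(j * b)) *+ 'C(e.+1, j).
  rewrite /A mulrA -exprSr -exprMn geom_poly exprBn; apply: eq_bigr => j _.
  by rewrite expr1n mulr1 -exprM mulnC.
have AE d : (A`_d)%:~R = \sum_(j < e.+2) (-1) ^+ j * 'C(e.+1, j)%:R *
    (if (j * b <= d)%N then 'C((d - j * b + e).-1, d - j * b)%:R else 0) :> K.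
  rewrite (coef_div_1subX d AB); under eq_bigr do rewrite coef_sum mulr_suml.
  rewrite exchange_big /= rmorph_sum /=; apply: eq_bigr => j _.
  have E u : ((-1) ^+ j * 'X^(j * b) *+ 'C(e.+1, j) : {poly int})`_u =
     (-1) ^+ j * 'C(e.+1, j)%:R * (u == (j * b)%N)%:R.
    rewrite coefMn [RHS]mulrAC mulr_natr -[(-1) ^+ j]signr_odd -[(-1) ^+ j in RHS]signr_odd.
    by congr (_ *+ _); case: (odd j); rewrite ?expr0 ?expr1 ?mul1r ?mulN1r ?coefN coefXn.
  under eq_bigr do rewrite E -[_ * _ * _ * _]mulrA.
  rewrite -mulr_sumr !rmorphM rmorphXn rmorphN rmorph1 /= rmorph_nat; congr (_ * _).
  case: leqP => jd; last first.
    rewrite big1 // => u _; case: eqP => [uj|]; last by rewrite mul0r.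
    by have := ltn_ord u; rewrite uj ltnS leqNgt jd.
  have jd' : (j * b < d.+1)%N by [].
  rewrite (bigD1 (Ordinal jd')) //= eqxx mul1r big1 ?addr0 ?rmorph_nat //.
  by move=> u; rewrite -val_eqE /= => /negPf->; rewrite mul0r.
rewrite int_horner_poly; under eq_bigr do rewrite AE mulr_suml.
rewrite exchange_big /= (bigID (fun j : 'I_ _ => P j)) /= [X in _ + X]big1 ?addr0.
  apply: eq_bigr => j Pj; under eq_bigr do rewrite -[_ * _ * _ * _]mulrA.
  rewrite -mulr_sumr; congr (_ * _); have [jL|jL] := leqP (j * b) L.
    by rewrite sum_shifted_binom.
  rewrite trunc_binom_eq0 ?mulr0 //; [|by apply: PL; rewrite // -ltnS|lia].
  rewrite big1 // => d _; rewrite leqNgt (leq_trans (ltn_ord d)) //= mul0r //.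
move=> j /NPL; rewrite -ltnS ltn_ord => /(_ isT) jL.
by rewrite big1 // => d _; rewrite leqNgt (leq_trans (ltn_ord d)) //= mulr0 mul0r.
Qed.
End ClosedForm.

(** * Two-sided linear recurrences *)

Section Recurrence.
Variable K : fieldType.
Implicit Types (p r : {poly K}) (f g : int -> K) (k : int).

(** The variable acts as the backward shift, so that a polynomial encodes a linear recurrence on
    two-sided sequences. *)
Definition shift_act p f k : K := \sum_(i < size p) p`_i * f (k - i%:Z).

Definition kills p f := forall k, shift_act p f k = 0.

Lemma shift_act_wide N p f k : (size p <= N)%N ->
  shift_act p f k = \sum_(i < N) p`_i * f (k - i%:Z).
Proof.
move=> pN; rewrite /shift_act (big_ord_widen N (fun i => p`_i * f (k - i%:Z))) //.
rewrite big_mkcond /=; apply: eq_bigr => i _; case: ltnP => // pi.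
by rewrite nth_default ?mul0r.
Qed.

Lemma shift_act_mulX p f k : shift_act (p * 'X) f k = shift_act p f (k - 1).
Proof.
rewrite (@shift_act_wide (size p).+1); last first.
  by rewrite (leq_trans (size_polyMleq _ _)) // size_polyX addn2.
rewrite big_ord_recl coefMX /= mul0r add0r; apply: eq_bigr => i _.
by rewrite coefMX /= /bump /=; congr (_ * f _); lia.
Qed.

Lemma shift_actD p r f k : shift_act (p + r) f k = shift_act p f k + shift_act r f k.
Proof.
pose N := maxn (size p) (size r).
rewrite !(@shift_act_wide N) ?leq_maxl ?leq_maxr ?size_polyD // -big_split /=.
by apply: eq_bigr => i _; rewrite coefD mulrDl.
Qed.

Lemma shift_actZ c p f k : shift_act (c *: p) f k = c * shift_act p f k.
Proof.
rewrite !(@shift_act_wide (size p)) ?size_scale_leq // mulr_sumr.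
by apply: eq_bigr => i _; rewrite coefZ mulrA.
Qed.

Lemma shift_act_mul1sub c p f k :
  shift_act ((1 - c *: 'X) * p) f k = shift_act p (fun k => f k - c * f (k - 1)) k.
Proof.
rewrite mulrBl mul1r -scalerAl -scaleNr shift_actD shift_actZ [_ * p]mulrC shift_act_mulX.
rewrite !(@shift_act_wide (size p)) // mulr_sumr -big_split /=.
by apply: eq_bigr => i _; rewrite (addrAC k); ring.
Qed.

Lemma kills_mul r p f : kills p f -> kills (r * p) f.
Proof.
move=> pf; elim/poly_ind: r => [|r c IH] k.
  by rewrite mul0r /shift_act size_poly0 big_ord0.
by rewrite mulrDl mulrAC shift_actD shift_act_mulX IH add0r mul_polyC shift_actZ pf mulr0.
Qed.

Lemma kills_sum p (I : finType) (P : pred I) (F : I -> int -> K) :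
  (forall i, P i -> kills p (F i)) -> kills p (fun k => \sum_(i | P i) F i k).
Proof.
move=> pF k; rewrite /shift_act; under eq_bigr do rewrite mulr_sumr.
by rewrite exchange_big big1 // => i Pi; apply: pF.
Qed.

Lemma killsD p f g : kills p f -> kills p g -> kills p (fun k => f k + g k).
Proof.
move=> pf pg k; rewrite /shift_act; under eq_bigr do rewrite mulrDr.
by rewrite big_split /= -/(shift_act p f k) -/(shift_act p g k) pf pg addr0.
Qed.

Lemma killsZ p c f : kills p f -> kills p (fun k => c * f k).
Proof.
move=> pf k; rewrite /shift_act; under eq_bigr do rewrite mulrCA.
by rewrite -mulr_sumr -/(shift_act p f k) pf mulr0.
Qed.

Lemma eq_kills p f g : f =1 g -> kills p f -> kills p g.
Proof. by move=> fg pf k; rewrite -[RHS](pf k); apply: eq_bigr => i _; rewrite fg. Qed.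

Lemma kills_geometric z p : z != 0 -> kills ((1 - z *: 'X) * p) (fun k => z ^ k).
Proof.
move=> z0 k; rewrite shift_act_mul1sub /shift_act big1 // => i _.
move: (k - i%:Z) => w.
by rewrite expfzDr // exprN1 mulrCA divff // mulr1 subrr mulr0.
Qed.

(** A polynomial and its translate have the same leading coefficient. *)
Lemma size_backward_diff e (Q : {poly K}) : (size Q <= e.+1)%N ->
  (size (Q - (Q \Po ('X - 1)))%R <= e)%N.
Proof.
have [->|Q0] := eqVneq Q 0; first by rewrite comp_poly0 subrr size_poly0.
move=> Qe; have sX : size ('X - 1 : {poly K}) = 2 by rewrite -polyC1 size_XsubC.
have cQ : (size (Q \Po ('X - 1)) <= e.+1)%N.
  by rewrite (leq_trans (size_comp_poly_leq _ _)) // sX muln1; case: (size Q) Qe.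
apply/leq_sizeP => j; rewrite leq_eqVlt => /orP[/eqP<-|ej]; rewrite ?coefB; last first.
  by rewrite !nth_default ?subrr // (leq_trans _ ej).
have [Qe'|Qe'] := leqP (size Q) e.
  rewrite !nth_default ?subrr // (leq_trans (size_comp_poly_leq _ _)) // sX muln1.
  by rewrite prednK // size_poly_gt0.
have sQ : size Q = e.+1 by apply/eqP; rewrite eqn_leq Qe.
have l1 : lead_coef ('X - 1 : {poly K}) = 1 by rewrite -polyC1 lead_coefXsubC.
have sC : size (Q \Po ('X - 1)) = e.+1.
  by rewrite size_comp_poly2 // sX.
have := @lead_coef_comp K Q ('X - 1); rewrite sX => /(_ isT).
by rewrite l1 expr1n mulr1 /lead_coef sC sQ /= => ->; rewrite subrr.
Qed.

(** Each factor [1 - z *: 'X] replaces [Q] by its backward difference, of smaller degree. *)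
Lemma kills_exp_poly z e (Q : {poly K}) : z != 0 -> (size Q <= e)%N ->
  kills ((1 - z *: 'X) ^+ e) (fun k => z ^ k * Q.[k%:~R]).
Proof.
move=> z0; elim: e Q => [|e IH] Q Qe k.
  move: Qe; rewrite size_poly_leq0 => /eqP->.
  by rewrite /shift_act big1 // => i _; rewrite horner0 !mulr0.
rewrite exprS shift_act_mul1sub -[RHS](IH _ (size_backward_diff Qe) k).
apply: eq_bigr => i _; congr (_ * _); move: (k - i%:Z) => w.
rewrite hornerD hornerN horner_comp !hornerE mulrBr expfzDr // exprN1 rmorphB /=.
by congr (_ - _); rewrite !mulrA; congr (_ * _); rewrite mulrC mulKf.
Qed.

End Recurrence.

(** * The two-sided Ehrhart sequence of a slice *)

Lemma ltn_ceil_div l m j : (0 < m)%N -> (j < ceil_div l m)%N = (j * m < l)%N.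
Proof. by move=> m0; rewrite /ceil_div leq_divRL // mulSn; lia. Qed.

Section SliceSequence.
Variable K : fieldType.
Hypothesis char0 : forall k, k.+1%:R != 0 :> K.
Variables (e l m : nat).
Hypotheses (m_gt0 : (0 < m)%N) (l_gt0 : (0 < l)%N) (l_le : (2 * l <= e.+1 * m)%N).

(* With [n = e + 1], the parameters [(eps, gam) = (1, 0)] give i_P(k; x) for
   [k >= 0], and [(-1, - n)] give the interior version for [k >= 1]. *)
Definition slice_seq (eps gam : int) (x : K) (k : int) : K :=
  \sum_(j < e.+2 | (j * m < l)%N) (-1) ^+ j * 'C(e.+1, j)%:R *
    (x ^ (j%:Z * (k * m%:Z + eps)) *
     trunc_binom e (k * (l%:Z - (j * m)%N%:Z) - j%:Z * eps + gam) x).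

Definition rising_binom_poly i (M c : int) : {poly K} :=
  (i`!%:R)^-1 *: \prod_(u < i) (M%:~R *: 'X + (c%:~R + u.+1%:R)%:P).

Lemma horner_rising_binom_poly i M c (k : int) :
  (rising_binom_poly i M c).[k%:~R] = rising_binom K i (k * M + c).
Proof.
rewrite hornerZ horner_prod; congr (_ * _); apply: eq_bigr => u _.
by rewrite !hornerE rmorphD rmorphM /=; ring.
Qed.

Lemma size_rising_binom_poly i M c : (size (rising_binom_poly i M c) <= i.+1)%N /\
  (rising_binom_poly i M c)`_i = (i`!%:R)^-1 * M%:~R ^+ i.
Proof.
rewrite /rising_binom_poly; set P := \prod_(u < i) _.
suff [s E] : (size P <= i.+1)%N /\ P`_i = M%:~R ^+ i.
  by split; rewrite ?coefZ ?E // (leq_trans (size_scale_leq _ _)).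
rewrite {}/P; elim: i => [|i [s E]]; first by rewrite big_ord0 size_poly1 coef1 expr0.
rewrite big_ord_recr /=; set p := \prod_(u < i) _ in s E *.
split.
  rewrite (leq_trans (size_polyMleq _ _)) //.
  have : (size (M%:~R *: 'X + (c%:~R + i.+1%:R)%:P : {poly K})%R <= 2)%N.
    by rewrite -mul_polyC size_MXaddC; case: ifP => // _; rewrite ltnS size_polyC leq_b1.
  by move: s; set a := size _; set b := size _; lia.
rewrite mulrDr -scalerAr coefD coefZ coefMX /= E coefMC nth_default ?mul0r ?addr0 //.
by rewrite exprS.
Qed.

Section Fixed.
Variable x : K.
Hypotheses (x0 : x != 0) (x1 : 1 - x != 0).

Lemma slice_seq_closed (k : nat) :
  int_horner x (\poly_(d < (k * l).+1)
    ((1 - 'X) * (\sum_(i < (k * m).+1) 'X^i) ^+ e.+1)`_d) = slice_seq 1 0 x k.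
Proof.
rewrite (trunc_box_poly char0 x0 x1 (P := fun j => j * m < l)%N) //.
- apply: eq_bigr => j _; congr (_ * (_ * trunc_binom _ _ _)); last by nia.
  by rewrite exprnP; congr (_ ^ _); nia.
(* From [j m < l] and [2 l <= (e + 1) m] follows [j <= e], hence
   [k l - j (k m + 1) >= - j >= - e]. *)
- move=> j _ jl; have : (j <= e)%N by nia.
  by nia.
- move=> j _; rewrite -leqNgt => lj.
  have : (k * l <= k * (j * m))%N by rewrite leq_mul2l lj orbT.
  by case: j lj => [|j] lj; nia.
Qed.

Lemma slice_seq_interior (k : nat) : (0 < k)%N ->
  int_horner x (if (e.+1 <= k * l)%N then \poly_(d < (k * l - e.+1).+1)
    ((1 - 'X) * (\sum_(i < (k * m - 2).+1) 'X^i) ^+ e.+1)`_d else 0) =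
  slice_seq (-1) (- e.+1%:Z) x k.
Proof.
move=> k0; case: ifP => nkl.
  (* Otherwise [k * m - 2] would be truncated; the bound follows from [e + 1 <= k l] and
     [2 l <= (e + 1) m]. *)
  have km2 : (2 <= k * m)%N by nia.
  rewrite (trunc_box_poly char0 x0 x1 (P := fun j => j * m < l)%N) //.
  - apply: eq_bigr => j _; congr (_ * (_ * trunc_binom _ _ _)); last by nia.
    by rewrite exprnP; congr (_ ^ _); nia.
  - move=> j _ jl; have : (k * (j * m) < k * l)%N by rewrite ltn_pmul2l.
    by nia.
  - move=> j je; rewrite -leqNgt => lj; have : (k * l <= k * (j * m))%N by rewrite leq_pmul2l.
    (* For [j <= e] the shift by [e + 1 - j] makes the inequality strict; for [j = e + 1] strictness
       comes from [2 l <= (e + 1) m]. *)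
    have [->|jn] := eqVneq j e.+1; last by nia.
    by nia.
(* When [k l < e + 1], every truncation index lies between [- e] and [-1]. *)
rewrite rmorph0 [RHS]big1 // => j jl; rewrite trunc_binom_eq0 ?mulr0 //.
  have : (k * (j * m) < k * l)%N by rewrite ltn_pmul2l.
  by nia.
have := ltn_ord j; have : (k * (j * m) < k * l)%N by rewrite ltn_pmul2l.
nia.
Qed.

Lemma slice_seq_recip (k : int) :
  slice_seq 1 0 x^-1 k = (-1) ^+ e * x ^+ e * slice_seq (-1) (- e.+1%:Z) x (- k).
Proof.
rewrite /slice_seq mulr_sumr; apply: eq_bigr => j _.
rewrite [RHS]mulrCA; congr (_ * _).
rewrite [X in trunc_binom e X x^-1](_ : _ = - (- k * (l%:Z - (j * m)%N%:Z) + j%:Z)); last by ring.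
rewrite trunc_binom_recip // mulrCA; congr (_ * _); congr (_ * trunc_binom _ _ _); last first.
  by move: (nat_of_ord j) => i; lia.
by rewrite -exprN1 exprz_exp; congr (_ ^ _); ring.
Qed.

(** The tails of all the truncations carry the same power [x ^ (l k)], whatever [j]; their
    coefficients, polynomial in [k], are collected here. *)
Definition slice_poly (eps gam : int) : {poly K} :=
  \sum_(j < e.+2 | (j * m < l)%N)
    (- ((-1) ^+ j * 'C(e.+1, j)%:R * x ^ (gam + 1) / (1 - x) ^+ e)) *:
    \sum_(i < e) (1 - x) ^+ i *:
      rising_binom_poly i (l%:Z - (j * m)%N%:Z) (gam - j%:Z * eps).

Lemma slice_seqE (eps gam k : int) :
  slice_seq eps gam x k =
  \sum_(j < e.+2 | (j * m < l)%N)
    ((-1) ^+ j * 'C(e.+1, j)%:R * x ^ (j%:Z * eps) / (1 - x) ^+ e) * (x ^+ (j * m)) ^ k +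
  (x ^+ l) ^ k * (slice_poly eps gam).[k%:~R].
Proof.
rewrite horner_sum mulr_sumr -big_split /=; apply: eq_bigr => j _.
rewrite hornerZ horner_sum /trunc_binom.
have -> : \sum_(i < e) ((1 - x) ^+ i *: rising_binom_poly i (l%:Z - (j * m)%N%:Z)
      (gam - j%:Z * eps)).[k%:~R] =
    \sum_(i < e) rising_binom K i (k * (l%:Z - (j * m)%N%:Z) - j%:Z * eps + gam) * (1 - x) ^+ i.
  apply: eq_bigr => i _; rewrite hornerZ horner_rising_binom_poly mulrC.
  by congr (rising_binom _ _ _ * _); ring.
move: (\sum_(i < e) _) => S.
have E1 : x ^ (j%:Z * (k * m%:Z + eps)) = (x ^+ (j * m)) ^ k * x ^ (j%:Z * eps).
  by rewrite exprnP exprz_exp -expfzDr //; congr (_ ^ _); rewrite PoszM; ring.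
have E2 : x ^ (j%:Z * (k * m%:Z + eps)) * x ^ (k * (l%:Z - (j * m)%N%:Z) - j%:Z * eps + gam + 1) =
   (x ^+ l) ^ k * x ^ (gam + 1).
  rewrite exprnP exprz_exp -!expfzDr //; congr (_ ^ _); rewrite PoszM; ring.
rewrite mulrBl mulrBr.
have -> (a b c d : K) : a * (b * c * d) = a * b * (c * d) by ring.
rewrite E2 E1; ring.
Qed.

Lemma size_slice_poly (eps gam : int) : (size (slice_poly eps gam) <= e)%N.
Proof.
apply: (leq_trans (size_sum _ _ _)); apply/bigmax_leqP => j _.
apply: (leq_trans (size_scale_leq _ _)); apply: (leq_trans (size_sum _ _ _)).
apply/bigmax_leqP => i _; apply: (leq_trans (size_scale_leq _ _)).
by apply: (leq_trans (size_rising_binom_poly _ _ _).1); apply: ltn_ord.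
Qed.

Lemma kills_slice_denom e' (eps gam : int) : (size (slice_poly eps gam) <= e')%N ->
  kills (map_poly (int_horner x) (slice_denom l m e')) (slice_seq eps gam x).
Proof.
move=> se; rewrite /slice_denom rmorphM rmorphXn rmorph_prod /=.
have E c : map_poly (int_horner x) (1 - qP ^+ c * tP) = 1 - x ^+ c *: 'X.
  rewrite rmorphB rmorph1 rmorphM rmorphXn /= /qP /tP map_polyX map_polyC /= int_horner_X.
  by rewrite -mul_polyC rmorphXn.
rewrite E; under eq_bigr do rewrite E.
apply: (eq_kills (fun k => esym (slice_seqE eps gam k))); apply: killsD.
  apply: kills_sum => j jl; apply: killsZ.
  have jJ : (j < ceil_div l m)%N by rewrite ltn_ceil_div.
  rewrite big_mkord (bigD1 (Ordinal jJ)) //= mulrCA.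
  by apply: kills_geometric; rewrite expf_neq0.
by rewrite mulrC; apply: kills_mul; apply: kills_exp_poly; rewrite ?expf_neq0.
Qed.

End Fixed.

(* Finite differences of order [n] annihilate the degree [n - 2]; for
   [2 l = n m] the terms [j] and [n - j] of the full alternating sum agree. *)
Lemma alternating_half_sum : (2 <= e)%N -> (2 * l = e.+1 * m)%N ->
  \sum_(j < e.+2 | (j * m < l)%N)
    (-1) ^+ j * 'C(e.+1, j)%:R * (l%:Z - (j * m)%N%:Z)%:~R ^+ e.-1 = 0 :> K.
Proof.
move=> e2 lm; set F := fun j : nat => (-1) ^+ j * 'C(e.+1, j)%:R * (l%:Z - (j * m)%N%:Z)%:~R ^+ e.-1 : K.
have tot : \sum_(j < e.+2) F j = 0.
  (* The value at [- j] is [(l - j m)^(e-1)], so [(1 - 'X)^(e+1)] acting at index 0 gives the full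
     alternating sum. *)
  pose Q : {poly K} := (m%:R *: 'X + l%:R%:P) ^+ e.-1.
  have sQ : (size Q <= e.+1)%N.
    apply: (leq_trans (size_poly_exp_leq _ _)).
    have : (size (m%:R *: 'X + l%:R%:P : {poly K})%R <= 2)%N.
      by rewrite -mul_polyC size_MXaddC; case: ifP => // _; rewrite ltnS size_polyC leq_b1.
    by set a := size _; nia.
  have := kills_exp_poly (oner_neq0 K) sQ 0.
  rewrite (@shift_act_wide _ e.+2); last first.
    apply: (leq_trans (size_poly_exp_leq _ _)).
    by rewrite scale1r -opprB size_polyN -polyC1 size_XsubC mul1n.
  move=> H; rewrite -[RHS]H {H}; apply: eq_bigr => j _.
  rewrite exp1rz mul1r /Q horner_exp !hornerE scale1r exprBn coef_sum.
  rewrite (bigD1 j) //= big1 ?addr0 => [|i ij].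
    rewrite expr1n mulr1 coefMn -signr_odd.
    have -> : ((-1) ^+ odd j * 'X^j : {poly K})`_j = (-1) ^+ odd j.
      by case: (odd j); rewrite ?expr0 ?expr1 ?mul1r ?mulN1r ?coefN coefXn eqxx.
    rewrite /F -signr_odd mulr_natr; congr (_ * _ ^+ _).
    by rewrite rmorphB rmorphN /= PoszM rmorphM /=; ring.
  have ij' : (nat_of_ord j == i) = false by rewrite eq_sym -(negPf ij).
  rewrite expr1n mulr1 coefMn -signr_odd.
  by case: (odd i); rewrite ?expr0 ?expr1 ?mul1r ?mulN1r ?coefN coefXn ij' ?oppr0 mul0rn.
have refl : \sum_(j < e.+2 | ~~ (j * m < l)%N) F j = \sum_(j < e.+2 | (j * m < l)%N) F j.
  (* A middle term [j m = l] vanishes because the exponent [e - 1] is positive. *)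
  rewrite (bigID (fun j : 'I_e.+2 => j * m == l)%N) /= big1 ?add0r; last first.
    move=> j /andP[_ /eqP jl]; rewrite /F jl subrr mulr0z expr0n.
    by rewrite (_ : (e.-1 == 0)%N = false) ?mulr0 //; lia.
  rewrite (reindex_inj rev_ord_inj) /=; apply: eq_big => [j|j jl].
    by have := ltn_ord j; rewrite subSS; nia.
  have je : (j <= e.+1)%N by rewrite -ltnS.
  rewrite subSS /F bin_sub //.
  have -> : l%:Z - ((e.+1 - j) * m)%N%:Z = - (l%:Z - (j * m)%N%:Z).
    by have := ltn_ord j; nia.
  rewrite rmorphN /=; move: (_%:~R) => M; rewrite (exprNn M) mulrA; congr (_ * _).
  rewrite mulrAC; congr (_ * _).
  rewrite -exprD -[LHS]signr_odd -[RHS]signr_odd; congr (_ ^+ nat_of_bool _).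
  by have := ltn_ord j; lia.
move: tot; rewrite (bigID (fun j : 'I_e.+2 => (j * m < l)%N)) /= refl -mulr2n => /eqP.
by rewrite -mulr_natl mulf_eq0 (negPf (char0 1)) => /eqP.
Qed.

(** Only the summand [i = e - 1] reaches degree [e - 1], and its leading coefficient is
    [(l - j m)^(e-1)] with a factor common to all [j], leaving the sum of [alternating_half_sum]. *)
Lemma size_slice_poly_half (x : K) (eps gam : int) :
  (2 <= e)%N -> (2 * l = e.+1 * m)%N ->
  (size (slice_poly x eps gam) <= e.-1)%N.
Proof.
move=> e2 lm; have eE : e.-1.+1 = e by rewrite prednK // ltnW.
apply/leq_sizeP => i; rewrite leq_eqVlt => /orP[/eqP<-|]; last first.
  by rewrite eE => ei; apply: nth_default; apply: leq_trans ei; apply: size_slice_poly.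
rewrite coef_sum; have e1 : (e.-1 < e)%N by rewrite eE.
pose c : K := - (x ^ (gam + 1) / (1 - x) ^+ e) * (1 - x) ^+ e.-1 * (e.-1`!%:R)^-1.
have E (j : 'I_e.+2) : ((- ((-1) ^+ j * 'C(e.+1, j)%:R * x ^ (gam + 1) / (1 - x) ^+ e)) *:
    \sum_(i < e) (1 - x) ^+ i *:
      rising_binom_poly i (l%:Z - (j * m)%N%:Z) (gam - j%:Z * eps))`_e.-1 =
    c * ((-1) ^+ j * 'C(e.+1, j)%:R * (l%:Z - (j * m)%N%:Z)%:~R ^+ e.-1).
  rewrite coefZ coef_sum (bigD1 (Ordinal e1)) //= big1 ?addr0 => [|i' ii].
    rewrite coefZ (size_rising_binom_poly _ _ _).2 /c; ring.
  rewrite coefZ nth_default ?mulr0 // (leq_trans (size_rising_binom_poly _ _ _).1) //.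
  by move: ii; rewrite -val_eqE /=; have := ltn_ord i'; lia.
by under eq_bigr do rewrite E; rewrite -mulr_sumr alternating_half_sum ?mulr0.
Qed.

End SliceSequence.

(** * Reciprocity of rational generating functions *)

Section Reciprocity.
Variable K : fieldType.
Implicit Types (p r : {poly K}) (g : int -> K).

(* [p = c X^s r(1/X)] *)
Definition reversal (s : nat) (c : K) p r :=
  [/\ (size p <= s.+1)%N, (size r <= s.+1)%N
    & forall i, (i <= s)%N -> p`_i = c * r`_(s - i)].

Lemma coef_1subZX_mul c p i :
  ((1 - c *: 'X) * p)`_i = p`_i - c * (if i is i'.+1 then p`_i' else 0).
Proof. by rewrite mulrBl mul1r -scalerAl coefB coefZ coefXM; case: i. Qed.

Lemma size_1subZX_mul c p s : (size p <= s)%N -> (size ((1 - c *: 'X) * p)%R <= s.+1)%N.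
Proof.
move/leq_sizeP=> ps; apply/leq_sizeP => -[//|i] si.
by rewrite coef_1subZX_mul !ps ?mulr0 ?subr0 // ltnW.
Qed.

(** Because [1 - X / z = - (X / z) (1 - z / X)]. *)
Lemma reversal_mul s c p r z : z != 0 -> reversal s c p r ->
  reversal s.+1 (- z^-1 * c) ((1 - z^-1 *: 'X) * p) ((1 - z *: 'X) * r).
Proof.
move=> z0 [ps rs pr]; split; rewrite ?size_1subZX_mul // => i.
rewrite !coef_1subZX_mul leq_eqVlt => /orP[/eqP->|].
  rewrite subnn nth_default // pr // subnn mulr0 subr0 sub0r; ring.
rewrite ltnS => si; rewrite subSn //; case: i si => [|i] si.
  rewrite subn0 (nth_default _ rs) pr // subn0; field.
  by [].
by rewrite !pr ?(ltnW si) // -subSn // subSS; field.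
Qed.

Lemma exprVB (t : K) s k : t != 0 -> (k <= s)%N -> t^-1 ^+ (s - k) = t^-1 ^+ s * t ^+ k.
Proof.
move=> t0 sk; rewrite -[in RHS](subnK sk) exprD -mulrA exprVn.
by rewrite [t^-1 ^+ k]exprVn mulVf ?mulr1 ?expf_neq0.
Qed.

Lemma horner_reversal s c p r t : t != 0 -> reversal s c p r ->
  p.[t^-1] = c * t^-1 ^+ s * r.[t].
Proof.
move=> t0 [ps rs pr]; rewrite (horner_coef_wide _ ps) (horner_coef_wide _ rs).
rewrite (reindex_inj rev_ord_inj) mulr_sumr; apply: eq_bigr => i _ /=.
have si : (i <= s)%N by rewrite -ltnS.
by rewrite subSS pr ?leq_subr // subKn // exprVB //; ring.
Qed.

(* The generating functions of [g] over [k > 0] and over [k <= 0], both brought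
   to the denominator [r], have opposite numerators. *)
Lemma recurrence_reciprocity s c p r g t : t != 0 -> reversal s c p r -> kills r g ->
  \sum_(k < s.+1) (\sum_(i < k.+1) p`_i * g (- (k%:Z - i%:Z))) * t^-1 ^+ k =
  - c * t^-1 ^+ s * \sum_(k < s.+1) (\sum_(i < k) r`_i * g (k%:Z - i%:Z)) * t ^+ k.
Proof.
move=> t0 [ps rs pr] rg; rewrite (reindex_inj rev_ord_inj) mulr_sumr.
apply: eq_bigr => k _ /=; have sk : (k <= s)%N by rewrite -ltnS.
rewrite subSS exprVB //; move: (nat_of_ord k) sk => {}k sk.
have -> : \sum_(i < (s - k).+1) p`_i * g (- ((s - k)%N%:Z - i%:Z)) =
    c * \sum_(k <= i < s.+1) r`_i * g (k%:Z - i%:Z).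
  rewrite mulr_sumr -[X in \sum_(X <= _ < _) _]add0n big_addn subSn // big_mkord.
  rewrite (reindex_inj rev_ord_inj); apply: eq_bigr => i _ /=.
  have ik : (i <= s - k)%N by rewrite -ltnS.
  rewrite subSS pr; last by rewrite (leq_trans (leq_subr _ _)) ?leq_subr.
  by rewrite mulrA; congr (c * r`_ _ * g _); lia.
(* The recurrence at [k], cut into the indices below [k] and the others, makes the two partial sums
   opposite. *)
have := rg k; rewrite (shift_act_wide _ _ rs) -(big_mkord xpredT (fun i => r`_i * g (k%:Z - i%:Z))).
rewrite (@big_cat_nat _ _ _ k) //=; last by rewrite ltnW.
rewrite big_mkord => /eqP; rewrite addrC addr_eq0 => /eqP->.
by move: (\sum_(i < k) _) => S; ring.
Qed.

End Reciprocity.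

(** * Recurrent sequences over the field of rational functions in t and q *)

Section RationalFunctions.

Lemma ratfun_char0 k : k.+1%:R != 0 :> ratfun.
Proof.
rewrite -[k.+1%:R](rmorph_nat (@tofrac polytq)) tofrac_eq0.
by rewrite -!polyC_natr !polyC_eq0 pnatr_eq0.
Qed.

Lemma qF_neq0 : qF != 0.
Proof. by rewrite tofrac_eq0 polyC_eq0 polyX_eq0. Qed.

Lemma tF_neq0 : tF != 0.
Proof. by rewrite tofrac_eq0 polyX_eq0. Qed.

Lemma subr1_qF_neq0 : 1 - qF != 0.
Proof.
rewrite subr_eq0 -(rmorph1 (@tofrac polytq)) tofrac_eq -polyC1.
apply/eqP => /polyC_inj/(congr1 (fun p : {poly int} => p`_0)).
by rewrite coef1 coefX.
Qed.

Lemma int_horner_qF (c : {poly int}) : int_horner qF c = tofrac (c%:P : polytq).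
Proof.
elim/poly_ind: c => [|c a IH]; first by rewrite rmorph0 polyC0 tofrac0.
rewrite rmorphD rmorphM /= int_horner_X IH polyCD polyCM tofracD tofracM; congr (_ + _).
by rewrite /int_horner map_polyC hornerC /= -[a in RHS]intz !rmorph_int.
Qed.

Lemma int_horner_qF_inj : injective (int_horner qF).
Proof. by move=> a b; rewrite !int_horner_qF => /eqP; rewrite tofrac_eq => /eqP/polyC_inj. Qed.

Lemma tofrac_horner (N : polytq) : tofrac N = (map_poly (int_horner qF) N).[tF].
Proof.
elim/poly_ind: N => [|N c IH]; first by rewrite tofrac0 map_poly0 horner0.
rewrite [in RHS]rmorphD [in RHS]rmorphM /= map_polyX map_polyC hornerD hornerM hornerX hornerC /=.
by rewrite -IH tofracD tofracM int_horner_qF.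
Qed.

Definition series_numerator (D : polytq) (F : nat -> {poly int}) : polytq :=
  \poly_(k < size D) \sum_(i < k.+1) D`_i * F (k - i)%N.

Section Numerator.
Variables (D : polytq) (F : nat -> {poly int}) (f : int -> ratfun).
Hypothesis Df : kills (map_poly (int_horner qF) D) f.
Hypothesis Ff : forall k : nat, (0 < k)%N -> int_horner qF (F k) = f k.

(** From [size D] on, the sum involves only positive indices of [F], so the recurrence of [f]
    annihilates it. Agreement at index 0 is not assumed, since it fails for the interior series. *)
Lemma coef_series_numerator k :
  (series_numerator D F)`_k = \sum_(i < k.+1) D`_i * F (k - i)%N.
Proof.
rewrite coef_poly; case: ltnP => // Dk; apply/esym/int_horner_qF_inj.
rewrite rmorph_sum rmorph0 /= -[RHS](Df k) (@shift_act_wide _ k.+1); last first.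
  by rewrite (leq_trans (size_poly _ _)) // leqW.
apply: eq_bigr => i _; rewrite coef_map rmorphM /=.
have [iD|Di] := ltnP i (size D); last by rewrite nth_default // rmorph0 !mul0r.
by rewrite Ff ?subn_gt0 ?(leq_trans iD) // subzn // -ltnS.
Qed.

Lemma recurrence_is_ratfun (G : series2) : D != 0 -> (forall k d, G k d = (F k)`_d) ->
  is_ratfun G (tofrac (series_numerator D F) / tofrac D).
Proof.
move=> D0 GF; exists (series_numerator D F), D; split=> // k d.
rewrite coef_series_numerator coef_sum; apply: eq_bigr => i _.
by rewrite coefM; apply: eq_bigr => j _; rewrite GF.
Qed.

End Numerator.

Lemma slice_denom_neq0 l m e : slice_denom l m e != 0.
Proof.
have nz c : 1 - qP ^+ c * tP != 0.
  apply/eqP => /(congr1 (fun p : polytq => p`_0)).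
  by rewrite coefB coef1 coefMX subr0 coef0 => /eqP; rewrite oner_eq0.
rewrite /slice_denom mulf_neq0 ?expf_neq0 // prodf_seq_neq0.
by apply/allP => j _ /=; apply: nz.
Qed.

Lemma reversal_slice_denom l m e : exists s c, c != 0 /\
  reversal s c (map_poly (int_horner qF^-1) (slice_denom l m e))
               (map_poly (int_horner qF) (slice_denom l m e)).
Proof.
pose Q (D : polytq) := exists s c, c != 0 /\
  reversal s c (map_poly (int_horner qF^-1) D) (map_poly (int_horner qF) D).
have Q1 : Q 1.
  exists 0%N, 1; split; rewrite ?oner_neq0 // !rmorph1; split; rewrite ?size_poly1 // => -[] //.
  by rewrite mul1r.
have QM j D : Q D -> Q ((1 - qP ^+ j * tP) * D).
  move=> [s [c [c0 sc]]]; exists s.+1, (- (qF ^+ j)^-1 * c).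
  have E (x : ratfun) : map_poly (int_horner x) (1 - qP ^+ j * tP) = 1 - x ^+ j *: 'X.
    rewrite rmorphB rmorph1 rmorphM rmorphXn /= /qP /tP map_polyX map_polyC /= int_horner_X.
    by rewrite -mul_polyC rmorphXn.
  have qj := expf_neq0 j qF_neq0.
  split; first by apply: mulf_neq0 c0; rewrite oppr_eq0 invr_eq0.
  by rewrite !rmorphM /= !E exprVn; exact: reversal_mul qj sc.
rewrite -/(Q _) /slice_denom; elim: e => [|e IH]; last by rewrite exprS -mulrA; apply: QM.
by rewrite expr0 mul1r; elim/big_rec: _ => // j D _; apply: QM.
Qed.

End RationalFunctions.

(** * q-Ehrhart series of cube slices *)

Lemma hilb_set0 n d : hilb (set0 : set 'rV[int]_n) d = 0%N.
Proof.
have ZE (z : 'rV[int]_n) : set0 z <-> exists t : void, z = (fun t : void => match t with end) t.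
  by split=> [[]|[[]]].
have dim0 d' : \dim (evalv_space (fun t : void => match t return 'rV[int]_n with end) d') = 0%N.
  apply/eqP; rewrite dimv_eq0 -subv0; apply/subvP => v _.
  by rewrite memv0; apply/eqP/ffunP => -[].
by have := dim_evalv_spaceS ZE d; rewrite !dim0 addn0.
Qed.

Lemma cancel_reversal (K : fieldType) (A B c u q sg : K) :
  B != 0 -> c != 0 -> u != 0 -> sg * sg = 1 ->
  q * (A / B) = -1 * sg * (sg * q * (- c * u * A) / (c * u * B)).
Proof.
move=> B0 c0 u0 s2.
transitivity (sg * sg * (q * (A / B))); first by rewrite s2 mul1r.
by field; rewrite B0 u0 c0.
Qed.

Section SliceEhrhart.
Variables (e l m : nat).
Hypotheses (m_gt0 : (0 < m)%N) (l_gt0 : (0 < l)%N) (l_le : (2 * l <= e.+1 * m)%N).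

Definition closed_poly (k : nat) : {poly int} :=
  \poly_(d < (k * l).+1) ((1 - 'X) * (\sum_(i < (k * m).+1) 'X^i) ^+ e.+1)`_d.

Definition interior_poly (k : nat) : {poly int} :=
  if k == 0%N then 0 else
  if (e.+1 <= k * l)%N then \poly_(d < (k * l - e.+1).+1)
    ((1 - 'X) * (\sum_(i < (k * m - 2).+1) 'X^i) ^+ e.+1)`_d else 0.

Lemma qEhrhart_closed_poly (R : realType) k d :
  qEhrhart (@cube_slice R e.+1 l m) k d = (closed_poly k)`_d.
Proof.
rewrite /qEhrhart dilate_cube_slice //; last by nia.
rewrite lattice_points_cube_slice // hilb_slice_points; last by nia.
by rewrite coef_poly ltnS.
Qed.

Lemma qEhrhart_int_interior_poly (R : realType) k d :
  qEhrhart_int (@cube_slice R e.+1 l m) k d = (interior_poly k)`_d.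
Proof.
rewrite /qEhrhart_int /interior_poly; have [_|k0] := posnP k; first by rewrite coef0.
rewrite dilate_cube_slice //; last by nia.
rewrite lattice_points_relint //; last first.
  by apply/andP; split; nia.
case: ifP => nkl; last by rewrite hilb_set0 coef0.
rewrite hilb_slice_points; last by nia.
by rewrite coef_poly ltnS.
Qed.

(** At [1/q] the closed counts become values of the interior sequence [g] at nonpositive indices, by
    [slice_seq_recip]; [recurrence_reciprocity] then exchanges them with its values at positive
    indices. *)
Lemma slice_reciprocity (D := slice_denom l m e) :
  qF ^+ e * (tofrac (series_numerator D interior_poly) / tofrac D) =
  (-1) ^+ e.+1 * subst_inv (tofrac (series_numerator D closed_poly) / tofrac D).
Proof.
have [x0 x1] := (qF_neq0, subr1_qF_neq0).
have y1 : 1 - qF^-1 != 0.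
  by apply: contraNneq x1 => /eqP; rewrite subr_eq0 eq_sym invr_eq1 eq_sym -subr_eq0 => /eqP->.
have y0 := invr_neq0 x0.
have kills_seq (eps gam : int) : kills (map_poly (int_horner qF) D) (slice_seq e l m eps gam qF).
  exact: (kills_slice_denom m_gt0 x0 (size_slice_poly m_gt0 l_gt0 l_le qF eps gam)).
set g := slice_seq e l m (-1) (- e.+1%:Z) qF.
have gE (k : nat) : (0 < k)%N -> int_horner qF (interior_poly k) = g k.
  move=> k0; rewrite /interior_poly gtn_eqF //.
  exact: (slice_seq_interior ratfun_char0 m_gt0 l_gt0 l_le x0 x1 k0).
have fE (k : nat) : int_horner qF (closed_poly k) = slice_seq e l m 1 0 qF k.
  exact: (slice_seq_closed ratfun_char0 m_gt0 l_gt0 l_le x0 x1 k).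
have hE (k : nat) : int_horner qF^-1 (closed_poly k) = (-1) ^+ e * qF ^+ e * g (- k%:Z).
  rewrite -(slice_seq_recip ratfun_char0 m_gt0 l_gt0 l_le x0 x1).
  exact: (slice_seq_closed ratfun_char0 m_gt0 l_gt0 l_le y0 y1 k).
rewrite subst_invE; last exact: slice_denom_neq0.
have [s [c [c0 rev]]] := reversal_slice_denom l m e; rewrite -/D in rev.
have [_ sD _] := rev.
have sizeD : (size D <= s.+1)%N.
  by move: sD; rewrite (size_map_inj_poly int_horner_qF_inj) ?rmorph0.
have sizeN F : (size (series_numerator D F) <= s.+1)%N.
  by rewrite (leq_trans (size_poly _ _)).
have sizeM (x : ratfun) F : (size (map_poly (int_horner x) (series_numerator D F)) <= s.+1)%N.
  exact: leq_trans (size_poly _ _) (sizeN F).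
have numE : eval_inv (series_numerator D closed_poly) =
    (-1) ^+ e * qF ^+ e *
    (- c * tF^-1 ^+ s * tofrac (series_numerator D interior_poly)).
  rewrite [LHS](horner_coef_wide _ (sizeM qF^-1 closed_poly)).
  rewrite tofrac_horner (horner_coef_wide _ (sizeM qF interior_poly)).
  have -> : \sum_(k < s.+1) (map_poly (int_horner qF) (series_numerator D interior_poly))`_k * tF ^+ k =
     \sum_(k < s.+1) (\sum_(i < k) (map_poly (int_horner qF) D)`_i * g (k%:Z - i%:Z)) * tF ^+ k.
    apply: eq_bigr => k _; rewrite coef_map /= (coef_series_numerator (kills_seq _ _) gE).
    (* The interior series starts at index 1, so the term [i = k] drops out and the sum runs over
       [i < k]. *)
    rewrite rmorph_sum big_ord_recr /= subnn /interior_poly /= mulr0 rmorph0 addr0.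
    congr (_ * _); apply: eq_bigr => i _; rewrite rmorphM coef_map /=.
    by rewrite -/(interior_poly (k - i)) gE ?subn_gt0 // subzn // ltnW.
  rewrite -(recurrence_reciprocity tF_neq0 rev (kills_seq _ _)) mulr_sumr.
  apply: eq_bigr => k _; rewrite coef_map /= (coef_series_numerator (kills_seq _ _) (fun k _ => fE k)).
  rewrite rmorph_sum mulrA mulr_sumr; congr (_ * _); apply: eq_bigr => i _.
  rewrite rmorphM coef_map /= hE mulrCA; congr (_ * (_ * g _)).
  by rewrite subzn // -ltnS.
have denE : eval_inv D = c * tF^-1 ^+ s * tofrac D.
  by rewrite tofrac_horner -(horner_reversal tF_neq0 rev).
rewrite numE denE.
have D0 : tofrac D != 0 by rewrite tofrac_eq0 slice_denom_neq0.
have u0 : tF^-1 ^+ s != 0 by exact: expf_neq0 (invr_neq0 tF_neq0).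
have s2 : (-1) ^+ e * (-1) ^+ e = 1 :> ratfun by rewrite -expr2 sqrr_sign.
rewrite exprS; exact: cancel_reversal D0 c0 u0 s2.
Qed.

End SliceEhrhart.

Theorem theoremA (R : realType) (n m l : nat)
    (n_ge1 : (1 <= n)%N) (m_ge1 : (1 <= m)%N)
    (l_ge1 : (1 <= l)%N) (l_le_max : (l <= (n * m) %/ 2)%N) :
  exists E Ebar : ratfun,
    is_ratfun (qEhrhart (@cube_slice R n l m)) E /\
    is_ratfun (qEhrhart_int (@cube_slice R n l m)) Ebar /\
    (exists N : polytq, E = tofrac N / tofrac (slice_denom l m (n - 1))) /\
    qF ^+ (n - 1) * Ebar = (-1) ^+ n * subst_inv E /\
    ((3 <= n)%N -> (2 * l = n * m)%N ->
       exists N : polytq, E = tofrac N / tofrac (slice_denom l m (n - 2))).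
Proof.
case: n n_ge1 l_le_max => // e _; rewrite leq_divRL // mulnC subn1 /= => l_le.
have [x0 x1] := (qF_neq0, subr1_qF_neq0).
have kills_seq e' (eps gam : int) : (size (slice_poly e l m qF eps gam) <= e')%N ->
    kills (map_poly (int_horner qF) (slice_denom l m e')) (slice_seq e l m eps gam qF).
  exact: (kills_slice_denom m_ge1 x0).
have closedE (k : nat) : (0 < k)%N -> int_horner qF (closed_poly e l m k) = slice_seq e l m 1 0 qF k.
  move=> _; exact: (slice_seq_closed ratfun_char0 m_ge1 l_ge1 l_le x0 x1 k).
have interiorE (k : nat) : (0 < k)%N ->
    int_horner qF (interior_poly e l m k) = slice_seq e l m (-1) (- e.+1%:Z) qF k.
  move=> k0; rewrite /interior_poly gtn_eqF //.
  exact: (slice_seq_interior ratfun_char0 m_ge1 l_ge1 l_le x0 x1 k0).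
have sz := size_slice_poly m_ge1 l_ge1 l_le qF.
have ratE e' : (size (slice_poly e l m qF 1 0) <= e')%N ->
    is_ratfun (qEhrhart (@cube_slice R e.+1 l m))
      (tofrac (series_numerator (slice_denom l m e') (closed_poly e l m)) /
       tofrac (slice_denom l m e')).
  move=> se; apply: (recurrence_is_ratfun (kills_seq _ _ _ se) closedE (slice_denom_neq0 l m e')).
  by move=> k d; apply: qEhrhart_closed_poly.
exists (tofrac (series_numerator (slice_denom l m e) (closed_poly e l m)) /
        tofrac (slice_denom l m e)).
exists (tofrac (series_numerator (slice_denom l m e) (interior_poly e l m)) /
        tofrac (slice_denom l m e)).
split; first exact: ratE.
split.
  apply: (recurrence_is_ratfun (kills_seq _ _ _ (sz _ _)) interiorE (slice_denom_neq0 l m e)).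
  by move=> k d; apply: qEhrhart_int_interior_poly.
split; first by eexists.
split; first exact: slice_reciprocity.
(* The smaller denominator also annihilates the sequence; both quotients expand to the same series
   and are therefore equal. *)
move=> e2 lm; eexists; apply: is_ratfun_uniq (ratE e _) _; first exact: sz.
rewrite subSS subn1; apply: ratE.
exact: (size_slice_poly_half ratfun_char0 m_ge1 l_ge1 l_le qF 1 0 e2 lm).
Qed.
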